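(* Let $m=1$ and $d\ge3$, or $m=2$ and $d\ge4$, and let $N\ge1$. The connection coefficients and the entries of the Jacobi matrices for OPs of degrees $0,\dots,N$ (i.e. $\mathbb{C}_n^{(m,d)},A_{n,x}^{(m,d)},A_{n,y}^{(m,d)}$ for $0\le n\le N$ and $B_{n,x}^{(m,d)},B_{n,y}^{(m,d)}$ for $0\le n\le N-1$) can be computed, by the Lanczos (Gram–Schmidt) procedure in coefficient space starting from the multiplication matrices $\mathcal{X}^{(m,d)}$ and $\mathcal{Y}^{(m,d)}$, in $\mathcal{O}(Nd^4)$ arithmetic operations without re-orthogonalisation and in $\mathcal{O}(Nd^5)$ arithmetic operations with re-orthogonalisation.
   Context: Let $w$ be a non-negative weight function whose support is an interval $I=(a,b)$, $(a,\infty)$ or $(-\infty,\infty)$, with all moments finite, and let $\phi$ be a real polynomial of degree $d$; if $m=2$ assume $\phi>0$ on $I$ ($\phi$ may vanish at endpoints of $I$). Set $\gamma_{m,d}=\{(x,y)\in\mathbb{R}^2: y^m=\phi(x),\ x\in I\}$; polynomials are considered in $\mathbb{R}[x,y]/\langle y^m-\phi(x)\rangle$. For $m=1$, $\langle f,g\rangle_{\gamma_{1,d},w}=\int_I f(x,\phi(x))g(x,\phi(x))w(x)\,dx$; for $m=2$, $$\langle f,g\rangle_{\gamma_{2,d},w}=\int_I\big[f(x,\sqrt{\phi(x)})g(x,\sqrt{\phi(x)})+f(x,-\sqrt{\phi(x)})g(x,-\sqrt{\phi(x)})\big]w(x)\,dx.$$ $p_n(\omega;x)$ is the degree-$n$ orthonormal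 polynomial with respect to $\int fg\,\omega\,dx$ with positive leading coefficient. The (orthonormal) $P$-basis is: for $m=1$, $P^{(1,d)}_{n,0}=p_n(w;x)$, $n\ge0$; for $m=2$, $P^{(2,d)}_{n,0}=p_n(w;x)/\sqrt2$, $n\ge0$, and $P^{(2,d)}_{n,1}=y\,p_{n-1}(\phi w;x)/\sqrt2$, $n\ge1$; $\mathbf{P}^{(1,d)}=(P^{(1,d)}_{0,0}\ P^{(1,d)}_{1,0}\cdots)$, $\mathbf{P}^{(2,d)}=(P^{(2,d)}_{0,0}\ P^{(2,d)}_{1,0}\ P^{(2,d)}_{1,1}\ P^{(2,d)}_{2,0}\ P^{(2,d)}_{2,1}\cdots)$. The (banded, symmetric) multiplication matrices are defined by $x\mathbf{P}^{(m,d)}=\mathbf{P}^{(m,d)}\mathcal{X}^{(m,d)}$, $y\mathbf{P}^{(m,d)}=\mathbf{P}^{(m,d)}\mathcal{Y}^{(m,d)}$. Orthonormal OPs $Y^{(m,d)}_{n,k}$, $n\ge0$, $1\le k\le\min\{n+1,d\}$, are constructed as follows (''orthogonalising $f$'' means subtracting from $f$ its orthogonal projection onto the span of all previously constructed OPs and dividing by the norm of the result). $Y^{(m,d)}_{0,1}=P^{(m,d)}_{0,0}$. For $0\le n\le d-2$: orthogonalise $xY^{(m,d)}_{n,k}$ to get $Y^{(m,d)}_{n+1,k}$, in the order $k=1,\dots,n+1$, then orthogonalise $yY^{(m,d)}_{n,n+1}$ to get $Y^{(m,d)}_{n+1,n+2}$. For $n\ge d-1$: orthogonalise $yY^{(m,d)}_{n,k}$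 to get $Y^{(m,d)}_{n+1,k}$, in the order $k=1,\dots,d$. Put $\mathbb{Y}_n^{(m,d)}=(Y^{(m,d)}_{n,1}\ Y^{(m,d)}_{n,2}\cdots)$, and let $\mathbb{C}_n^{(m,d)}$ be the matrix of connection coefficients with $\mathbb{Y}_n^{(m,d)}=\mathbf{P}^{(m,d)}\mathbb{C}_n^{(m,d)}$. The blocks of the Jacobi matrices are $(A_{n,x}^{(m,d)})_{i,j}=\langle Y^{(m,d)}_{n,i},xY^{(m,d)}_{n,j}\rangle_{\gamma_{m,d},w}$, $(B_{n,x}^{(m,d)})_{i,j}=\langle Y^{(m,d)}_{n+1,i},xY^{(m,d)}_{n,j}\rangle_{\gamma_{m,d},w}$, and likewise with $y$. In coefficient space every polynomial is represented by its column of coefficients in the $P$-basis; multiplication by $x$, $y$ is multiplication by $\mathcal{X}^{(m,d)},\mathcal{Y}^{(m,d)}$, and the inner product is the Euclidean one. Without re-orthogonalisation, in computing an OP of degree $n+1$ only the components along the already constructed OPs of degrees $n-1,n,n+1$ are subtracted (the others vanish in exact arithmetic by the three-term recurrences). Re-orthogonalisation is the additional step of replacing each newly computed $Y^{(m,d)}_{n+1,k}$ by $Y^{(m,d)}_{n+1,k}-\sum\langle Y^{(m,d)}_{n+1,k},Y^{(m,d)}_{s,i}\rangle_{\gamma_{m,d},w}Y^{(m,d)}_{s,i}$, the sum being over the previously computed OPs $Y^{(m,d)}_{s,i}$ with $n-d+3\le s\le n+1$ if $m=1$, and with $n-d+4\le s\le n+1$ if $m=2$. The implied constants are absolute (independent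 of $N$, $d$, $\phi$, $w$). *)

(* Defs.v *)
From mathcomp Require Import all_boot all_order all_algebra qpoly.
From mathcomp Require Import all_classical all_reals all_analysis.
Import Order.TTheory GRing.Theory Num.Theory.
Import numFieldTopology.Exports numFieldNormedType.Exports.

Set Implicit Arguments.
Unset Strict Implicit.
Unset Printing Implicit Defensive.

Local Open Scope classical_set_scope.
Local Open Scope ring_scope.

(** * Weights and univariate orthonormal polynomials *)

Section Weights.
Context {R : realType}.
Implicit Types (I : set R) (w : R -> R).

(* Support of the measure w(t) dt (insensitive to null sets, unlike the
   closure of the set where w is nonzero). *)
Definition weight_support w : set R :=
  [set s | forall e : R, 0 < e ->
     (0 < \int[lebesgue_measure]_(t in ball s e) (w t)%:E)%E].

Record is_weight I w : Prop := IsWeight {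
  weight_interval :
    (exists a b : R, a < b /\ I = [set` `]a, b[]) \/
    (exists a : R, I = [set` `]a, +oo[]) \/
    I = [set: R];
  weight_ge0 : forall t, 0 <= w t;
  weight_measurable : measurable_fun [set: R] w;
  weight_supportE : weight_support w = closure I;
  weight_moments : forall n : nat,
    lebesgue_measure.-integrable I (fun t => (t ^+ n * w t)%:E) }.

(* p n is the polynomial written p_n(w; x). *)
Record is_orthonormal_polys I w (p : nat -> {poly R}) : Prop :=
  IsOrthonormalPolys {
    op_size : forall n, size (p n) = n.+1;
    op_lead : forall n, 0 < lead_coef (p n);
    op_ortho : forall i j,
      Rintegral lebesgue_measure I (fun t => (p i).[t] * (p j).[t] * w t)
      = (i == j)%:R }.

End Weights.

(** * The curve y^m = phi(x) *)

Section Curve.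
Context {R : realType}.
Variables (m : nat) (phi : {poly R}).

(* In {poly {poly R}} the outer indeterminate is y and the inner one is x.
   For 0 < m the polynomial below is monic of size m.+1 > 1, so {poly %/ _} is
   the genuine quotient ring R[x,y]/<y^m - phi(x)>. *)
Definition curve_eqn : {poly {poly R}} := 'X^m - phi%:P.
Definition curve_ring := {poly %/ curve_eqn}.

Definition xpoly (p : {poly R}) : curve_ring := in_qpoly curve_eqn p%:P.
Definition curve_x : curve_ring := xpoly 'X.
Definition curve_y : curve_ring := in_qpoly curve_eqn 'X.

Definition curve_scale (c : R) (f : curve_ring) : curve_ring := c%:P *: f.
Definition curve_eval (f : curve_ring) (x y : R) : R := f.[y%:P].[x].

(* The values of y above t; only m = 1 and m = 2 are used. *)
Definition branches (t : R) : seq R :=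
  if m == 1%N then [:: phi.[t]]
  else [:: Num.sqrt phi.[t]; - Num.sqrt phi.[t]].

Definition curve_ip (I : set R) (w : R -> R) (f g : curve_ring) : R :=
  Rintegral lebesgue_measure I (fun t =>
    (\sum_(s <- branches t) curve_eval f t s * curve_eval g t s) * w t).

(* Here p n = p_n(w; x) and q n = p_n(phi w; x).  For m = 2 the order
   P_{0,0}, P_{1,0}, P_{1,1}, P_{2,0}, P_{2,1}, ... puts P_{n,0} at index
   2n - 1 (and 0 for n = 0) and P_{n,1} at index 2n. *)
Definition pbasis (p q : nat -> {poly R}) (j : nat) : curve_ring :=
  if m == 1%N then xpoly (p j)
  else if (j == 0%N) || odd j
  then curve_scale (Num.sqrt 2)^-1 (xpoly (p (uphalf j)))
  else curve_scale (Num.sqrt 2)^-1 (curve_y * xpoly (q (j./2).-1)).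

(* f = P c, for a finitely supported column c. *)
Definition is_coords (P : nat -> curve_ring) (f : curve_ring) (c : nat -> R) :=
  exists2 K : nat, forall i, (K <= i)%N -> c i = 0 &
    f = \sum_(i < K) curve_scale (c i) (P i).

(* z P = P M *)
Definition is_mult_matrix (P : nat -> curve_ring) (z : curve_ring)
    (M : nat -> nat -> R) :=
  forall j, is_coords P (z * P j) (M ^~ j).

End Curve.

(** * The orthonormal polynomials Y_{n,k} on the curve *)

(* What is to be orthogonalised to get degree n.+1, in order, given the list
   lvl of OPs of degree n; for n.+1 < d, lvl has n.+1 elements and drop n keeps
   the last one. *)
Definition candidates (A B : Type) (d n : nat) (mulx muly : A -> B)
    (lvl : seq A) : seq B :=
  if (n.+1 < d)%N then map mulx lvl ++ map muly (drop n lvl)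
  else map muly lvl.

Section CurveOPs.
Context {R : realType}.
Variables (m d : nat) (phi : {poly R}) (I : set R) (w : R -> R).
Local Notation E := (curve_ring m phi).
Local Notation ip := (@curve_ip R m phi I w).

(* prev is an orthonormal list *)
Definition orthogonalise (prev : seq E) (f : E) : E :=
  let g := f - \sum_(h <- prev) curve_scale (ip f h) h in
  curve_scale (Num.sqrt (ip g g))^-1 g.

Fixpoint orthogonalise_seq (prev cands : seq E) : seq E :=
  if cands is f :: cands' then
    let g := orthogonalise prev f in
    g :: orthogonalise_seq (rcons prev g) cands'
  else [::].

(* OPs of degrees 0, ..., n, grouped by degree *)
Fixpoint op_levels (P00 : E) (n : nat) : seq (seq E) :=
  if n is n'.+1 then
    let L := op_levels P00 n' in
    rcons L (orthogonalise_seq (flatten L)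
      (candidates d n' ( *%R (curve_x m phi)) ( *%R (curve_y m phi))
         (last [::] L)))
  else [:: [:: P00]].

(* Y_{n,k+1}: the second index starts at 0 here. *)
Definition curve_op (P00 : E) (n k : nat) : E :=
  nth 0 (last [::] (op_levels P00 n)) k.

End CurveOPs.

(** * Arithmetic programs *)

Inductive arith_op := OpAdd | OpSub | OpMul | OpDiv.

(* Programs over an abstract type V of numbers: the only way to produce a new
   number is an Arith or Sqrt instruction, and each of them costs one. *)
Inductive prog (V A : Type) : Type :=
| Ret of A
| Arith of arith_op & V & V & (V -> prog V A)
| Sqrt of V & (V -> prog V A).
Arguments Ret {V A} _.
Arguments Arith {V A} _ _ _ _.
Arguments Sqrt {V A} _ _.

Definition arith_sem (R : realType) (o : arith_op) (x y : R) : R :=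
  match o with
  | OpAdd => x + y | OpSub => x - y | OpMul => x * y | OpDiv => x / y
  end.

Fixpoint run_prog (R : realType) (A : Type) (p : prog R A) : A :=
  match p with
  | Ret a => a
  | Arith o x y k => run_prog (k (arith_sem o x y))
  | Sqrt x k => run_prog (k (Num.sqrt x))
  end.

Fixpoint op_count (R : realType) (A : Type) (p : prog R A) : nat :=
  match p with
  | Ret _ => 0%N
  | Arith o x y k => (op_count (k (arith_sem o x y))).+1
  | Sqrt x k => (op_count (k (Num.sqrt x))).+1
  end.

Fixpoint bind (V A B : Type) (p : prog V A) (f : A -> prog V B) : prog V B :=
  match p with
  | Ret a => f a
  | Arith o x y k => Arith o x y (fun v => bind (k v) f)
  | Sqrt x k => Sqrt x (fun v => bind (k v) f)
  end.

Notation "'let!' x ':=' p 'in' k" := (bind p (fun x => k))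
  (at level 200, x name, p at level 200, k at level 200).

Section Combinators.
Context {V : Type}.

Fixpoint map_prog (A B : Type) (f : A -> prog V B) (s : seq A) :
    prog V (seq B) :=
  if s is a :: s' then
    let! b := f a in let! t := map_prog f s' in Ret (b :: t)
  else Ret [::].

Fixpoint fold_prog (A B : Type) (f : B -> A -> prog V B) (b : B) (s : seq A) :
    prog V B :=
  if s is a :: s' then let! c := f b a in fold_prog f c s' else Ret b.

Definition arith (o : arith_op) (x y : V) : prog V V := Arith o x y Ret.

End Combinators.

(** * The Lanczos procedure in coefficient space *)

(* A coefficient vector stored on the window start, start + 1, ... of length
   size entries; it is zero outside. *)
Record bvec (V : Type) := BVec { start : nat; entries : seq V }.

(* The windows (first index, length) on which the columns of C_n are stored,
   and the half-bandwidths of the two multiplication matrices. *)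
Record storage := Storage {
  window : nat -> nat * nat;
  xband : nat;
  yband : nat }.

(* Component (n, j, i) of the list of A_n or B_n blocks is the entry in row i
   and column j of the n-th block. *)
Record lanczos_output (V : Type) := LanczosOutput {
  out_C : seq (seq (bvec V));
  out_Ax : seq (seq (seq V));
  out_Ay : seq (seq (seq V));
  out_Bx : seq (seq (seq V));
  out_By : seq (seq (seq V)) }.

Section Lanczos.
Context {V : Type}.
Variables (zero one : V).

Definition coef (v : bvec V) (i : nat) : V :=
  if (i < start v)%N then zero else nth zero (entries v) (i - start v).

Definition indices (v : bvec V) : seq nat := iota (start v) (size (entries v)).

Definition dot (u v : bvec V) : prog V V :=
  fold_prog (fun acc i =>
    let! t := arith OpMul (coef u i) (coef v i) in arith OpAdd acc t)
    zero (indices u).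

(* M v for M of half-bandwidth b *)
Definition band_mul (b : nat) (M : nat -> nat -> V) (v : bvec V) :
    prog V (bvec V) :=
  let lo := (start v - b)%N in
  let hi := (start v + size (entries v) + b)%N in
  let! s := map_prog (fun i =>
      fold_prog (fun acc j =>
        let! t := arith OpMul (M i j) (coef v j) in arith OpAdd acc t)
        zero [seq j <- indices v | (i <= j + b)%N && (j <= i + b)%N])
    (iota lo (hi - lo)) in
  Ret (BVec lo s).

(* g - sum_u <g, u> u, computed on the window win *)
Definition subtract_components (win : nat * nat) (us : seq (bvec V))
    (g : bvec V) : prog V (bvec V) :=
  let! hs := map_prog (fun u => dot u g) us in
  let! s := map_prog (fun i =>
      fold_prog (fun acc (hu : V * bvec V) =>
        let! t := arith OpMul hu.1 (coef hu.2 i) in arith OpSub acc t)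
        (coef g i) (zip hs us))
    (iota win.1 win.2) in
  Ret (BVec win.1 s).

Definition normalise (v : bvec V) : prog V (bvec V) :=
  let! s := dot v v in
  Sqrt s (fun r =>
    let! e := map_prog (fun x => arith OpDiv x r) (entries v) in
    Ret (BVec (start v) e)).

Variables (reorth : bool) (m d : nat) (S : storage).
Variables (MX MY : nat -> nat -> V).

Definition mul_x : bvec V -> prog V (bvec V) := band_mul (xband S) MX.
Definition mul_y : bvec V -> prog V (bvec V) := band_mul (yband S) MY.

(* L lists the OPs of degrees 0, ..., n by degree, cur those of degree n.+1
   computed so far.  Components are subtracted along degrees n-1, n, n+1.  The
   re-orthogonalisation starts at degree n - d + 3 for m = 1 and n - d + 4 for
   m = 2; truncated subtraction makes a negative bound 0. *)
Definition next_op (n : nat) (L : seq (seq (bvec V))) (cur : seq (bvec V))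
    (cand : prog V (bvec V)) : prog V (bvec V) :=
  let win := window S n.+1 in
  let! g := cand in
  let! r := subtract_components win (flatten (drop n.-1 L) ++ cur) g in
  let! v := normalise r in
  if reorth then
    subtract_components win (flatten (drop (n + m + 2 - d)%N L) ++ cur) v
  else Ret v.

Definition next_level (n : nat) (L : seq (seq (bvec V))) :
    prog V (seq (bvec V)) :=
  fold_prog (fun cur cand => let! v := next_op n L cur cand in
                             Ret (rcons cur v))
    [::] (candidates d n mul_x mul_y (last [::] L)).

Fixpoint lanczos_levels (N : nat) : prog V (seq (seq (bvec V))) :=
  if N is n.+1 then
    let! L := lanczos_levels n in
    let! l := next_level n L in
    Ret (rcons L l)
  else Ret [:: [:: BVec 0 [:: one]]].

Definition jacobi_block (mul : bvec V -> prog V (bvec V))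
    (rows cols : seq (bvec V)) : prog V (seq (seq V)) :=
  map_prog (fun v =>
    let! z := mul v in map_prog (fun u => dot u z) rows) cols.

Definition jacobi_blocks (mul : bvec V -> prog V (bvec V)) (shift len : nat)
    (L : seq (seq (bvec V))) : prog V (seq (seq (seq V))) :=
  map_prog (fun n =>
    jacobi_block mul (nth [::] L (n + shift)%N) (nth [::] L n)) (iota 0 len).

Definition lanczos (N : nat) : prog V (lanczos_output V) :=
  let! L := lanczos_levels N in
  let! Ax := jacobi_blocks mul_x 0 N.+1 L in
  let! Ay := jacobi_blocks mul_y 0 N.+1 L in
  let! Bx := jacobi_blocks mul_x 1 N L in
  let! By := jacobi_blocks mul_y 1 N L in
  Ret (LanczosOutput L Ax Ay Bx By).

(* Entry (i, k) of C_n, and entry (i, j) of the n-th block. *)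
Definition conn_entry (o : lanczos_output V) (n i k : nat) : V :=
  coef (nth (BVec 0 [::]) (nth [::] (out_C o) n) k) i.
Definition block_entry (T : seq (seq (seq V))) (n i j : nat) : V :=
  nth zero (nth [::] (nth [::] T n) j) i.

End Lanczos.

(* The output o holds C_n, A_{n,x}, A_{n,y} for n <= N and B_{n,x}, B_{n,y} for
   n < N, where P is the P-basis and Y the family of OPs. *)
Record lanczos_correct (R : realType) (m d : nat) (phi : {poly R})
    (I : set R) (w : R -> R) (P : nat -> curve_ring m phi)
    (Y : nat -> nat -> curve_ring m phi) (N : nat) (o : lanczos_output R)
    : Prop := LanczosCorrect {
  correct_C : forall n k, (n <= N)%N -> (k < minn n.+1 d)%N ->
    is_coords P (Y n k) (fun i => conn_entry 0 o n i k);
  correct_Ax : forall n i j, (n <= N)%N ->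
    (i < minn n.+1 d)%N -> (j < minn n.+1 d)%N ->
    block_entry 0 (out_Ax o) n i j
    = curve_ip I w (Y n i) (curve_x m phi * Y n j);
  correct_Ay : forall n i j, (n <= N)%N ->
    (i < minn n.+1 d)%N -> (j < minn n.+1 d)%N ->
    block_entry 0 (out_Ay o) n i j
    = curve_ip I w (Y n i) (curve_y m phi * Y n j);
  correct_Bx : forall n i j, (n < N)%N ->
    (i < minn n.+2 d)%N -> (j < minn n.+1 d)%N ->
    block_entry 0 (out_Bx o) n i j
    = curve_ip I w (Y n.+1 i) (curve_x m phi * Y n j);
  correct_By : forall n i j, (n < N)%N ->
    (i < minn n.+2 d)%N -> (j < minn n.+1 d)%N ->
    block_entry 0 (out_By o) n i j
    = curve_ip I w (Y n.+1 i) (curve_y m phi * Y n j) }.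

(* Main.v *)
Require Import Defs.
From mathcomp Require Import all_boot all_order all_algebra qpoly.
From mathcomp Require Import all_classical all_reals all_analysis.
From mathcomp Require Import zify ring.
Import Order.TTheory GRing.Theory Num.Theory.
Local Open Scope ring_scope.

(** The P-basis is orthonormal and complete ([pbasis_orthonormal],
    [basis_complete]), so the coefficient of f along P_i is <f, P_i>, and the
    coefficient vectors with the Euclidean product are an exact model of the
    polynomials on the curve: [vec_curve] turns every vector operation of the
    procedure into the corresponding operation on polynomials.

    Let Pi_n be the polynomials of total degree at most n.  The OPs of degrees
    at most n span Pi_n ([op_levels_span]).  Only some of the products x Y, y Y
    are orthogonalised, but the missing ones follow from the others by
    commuting x and y, and x ^ (n+1) with n+1 >= d follows from y products
    because phi(x) = y ^ m.  Consequently an OP Y of degree n is orthogonal to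
    Pi_(n-1), and <z Y, Y'> = <Y, z Y'> vanishes for z = x, y as soon as
    deg Y' <= n - 2: subtracting the components along three degrees, with or
    without re-orthogonalisation, gives the full Gram-Schmidt step
    ([mul_level_orthogonal], [vec_curve_next_op]).

    The cost rests on the sparsity of the OPs.  On one side, an element of Pi_n
    only involves P_0, ..., P_(dn), since indices count the degree in x m times
    and y ^ m = phi has degree d in x ([Pi_in_first]).  On the other side,
    repeated division by phi = y ^ m shows that P_i lies in Pi_(n-1) for
    i < d (n - d) ([Pi_basis]), so an OP of degree n has no component there.
    Its coefficient vector therefore lives on the d^2 + 1 indices from d (n - d)
    to dn ([window_coef]); for n < d the window starts at 0.  With
    half-bandwidth 2d for both multiplication matrices, one multiplication costs
    O(d^3), and removing the components along at most 3d OPs costs O(d^3); the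
    re-orthogonalisation removes at most d^2 components and costs O(d^4).  There
    are at most d OPs in each degree, and a column of a Jacobi block costs one
    multiplication and d dot products of length O(d^2) ([lanczos_cost]).

    The argument allows a residual to be zero: normalising it gives
    0 / sqrt 0 = 0 on the curve and in coefficient space alike, and a zero
    vector changes neither spans nor projections.  The invariant of the
    procedure is hence that the OPs are pairwise orthogonal and each of them is
    zero or of norm one ([orthonormal_or_zero]). *)

Set Implicit Arguments.
Unset Strict Implicit.
Unset Printing Implicit Defensive.

(** * Sequences *)

Lemma flatten_rcons (T : Type) (ss : seq (seq T)) s :
  flatten (rcons ss s) = flatten ss ++ s.
Proof. by rewrite -cats1 flatten_cat /= cats0. Qed.

Lemma all_drop (T : Type) (a : pred T) k (s : seq T) :
  all a s -> all a (drop k s).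
Proof. by rewrite -{1}(cat_take_drop k s) all_cat => /andP[]. Qed.

Lemma all_flatten (T : Type) (a : pred T) (ss : seq (seq T)) :
  all a (flatten ss) = all (all a) ss.
Proof. by elim: ss => //= s ss IH; rewrite all_cat IH. Qed.

Lemma size_flatten_le (T : Type) k (ss : seq (seq T)) :
  all (fun s => size s <= k)%N ss -> (size (flatten ss) <= size ss * k)%N.
Proof.
by elim: ss => //= s ss IH /andP[sk /IH ssk]; rewrite size_cat mulSn leq_add.
Qed.

(** * Semantics and cost of arithmetic programs *)

Section ProgramSemantics.
Context {R : realType}.
Implicit Types (A B : Type).

Lemma run_bind A B (p : prog R A) (f : A -> prog R B) :
  run_prog (bind p f) = run_prog (f (run_prog p)).
Proof. by elim: p => //= [? ? ? k IH|? k IH]; rewrite IH. Qed.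

Lemma count_bind A B (p : prog R A) (f : A -> prog R B) :
  op_count (bind p f) = (op_count p + op_count (f (run_prog p)))%N.
Proof. by elim: p => //= [? ? ? k IH|? k IH]; rewrite IH. Qed.

Lemma run_map_prog A B (f : A -> prog R B) (s : seq A) :
  run_prog (map_prog f s) = [seq run_prog (f a) | a <- s].
Proof. by elim: s => //= a s IH; rewrite !run_bind IH. Qed.

Lemma run_fold_prog A B (f : B -> A -> prog R B) b (s : seq A) :
  run_prog (fold_prog f b s) = foldl (fun c a => run_prog (f c a)) b s.
Proof. by elim: s b => //= a s IH b; rewrite run_bind IH. Qed.

Lemma count_map_prog A B (a : pred A) (f : A -> prog R B) c (s : seq A) :
  (forall x, a x -> (op_count (f x) <= c)%N) -> all a s ->
  (op_count (map_prog f s) <= size s * c)%N.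
Proof.
move=> fc; elim: s => //= x s IH /andP[ax /IH sc].
by rewrite !count_bind /= addn0 mulSn leq_add ?fc.
Qed.

Lemma count_fold_prog A B (f : B -> A -> prog R B) c b (s : seq A) :
  (forall b x, (op_count (f b x) <= c)%N) ->
  (op_count (fold_prog f b s) <= size s * c)%N.
Proof.
move=> fc; elim: s b => //= x s IH b.
by rewrite count_bind mulSn leq_add ?fc.
Qed.

Lemma foldl_add A (F : A -> R) z s :
  foldl (fun acc a => acc + F a) z s = z + \sum_(a <- s) F a.
Proof.
elim: s z => [|a s IH] z /=; first by rewrite big_nil addr0.
by rewrite IH big_cons addrA.
Qed.

Lemma foldl_sub_zip A (h F : A -> R) z s :
  foldl (fun acc (hu : R * A) => acc - hu.1 * F hu.2) z
    (zip [seq h a | a <- s] s) = z - \sum_(a <- s) h a * F a.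
Proof.
elim: s z => [|a s IH] z /=; first by rewrite big_nil subr0.
by rewrite IH big_cons opprD addrA.
Qed.

End ProgramSemantics.

(** * Coefficient vectors *)

Section VectorPrograms.
Context {R : realType}.
Local Notation coef := (@coef R 0).
Local Notation dot := (@dot R 0).
Local Notation band_mul := (@band_mul R 0).
Local Notation subtract_components := (@subtract_components R 0).
Local Notation normalise := (@normalise R 0).
Implicit Types (u v g : bvec R) (us : seq (bvec R)) (M : nat -> nat -> R).

Lemma coef_window (F : nat -> R) lo n i :
  coef (BVec lo [seq F j | j <- iota lo n]) i =
  if (lo <= i < lo + n)%N then F i else 0.
Proof.
rewrite /coef /=; case: (ltnP i lo) => //= lei.
case: (ltnP i (lo + n)) => ltin; last first.
  by rewrite nth_default // size_map size_iota; lia.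
have lt_n : (i - lo < n)%N by lia.
by rewrite (nth_map 0%N) ?size_iota // nth_iota // subnKC.
Qed.

Lemma run_dot u v :
  run_prog (dot u v) = \sum_(i <- indices u) coef u i * coef v i.
Proof. by rewrite /dot run_fold_prog /= foldl_add add0r. Qed.

Lemma coef_out v (i : nat) : i \notin indices v -> coef v i = 0.
Proof.
rewrite /indices /coef mem_iota; case: (ltnP i (start v)) => //= lei nlt.
by rewrite nth_default //; lia.
Qed.

(** The program only multiplies inside the band and stores the window widened by
    b on both sides; outside the band M vanishes, so nothing is lost. *)
Lemma coef_band_mul b M v i :
  (forall i j, (j + b < i)%N || (i + b < j)%N -> M i j = 0) ->
  coef (run_prog (band_mul b M v)) i
  = \sum_(j <- indices v) M i j * coef v j.
Proof.
move=> bandM; rewrite /band_mul run_bind run_map_prog /= coef_window.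
case: ifP => [_|/negbT nin].
  rewrite run_fold_prog /= foldl_add add0r big_filter big_mkcond /=.
  apply: eq_bigr => j _; case: ifP => // /negbT nb.
  by rewrite bandM ?mul0r //; lia.
rewrite big_seq big1 // => j; rewrite mem_iota => jin.
by rewrite bandM ?mul0r //; lia.
Qed.

Lemma coef_subtract win us g i :
  coef (run_prog (subtract_components win us g)) i =
  if (win.1 <= i < win.1 + win.2)%N
  then coef g i - \sum_(u <- us) run_prog (dot u g) * coef u i else 0.
Proof.
rewrite /subtract_components !run_bind !run_map_prog /= coef_window.
by rewrite run_fold_prog /= (foldl_sub_zip _ (fun u => coef u i)).
Qed.

Lemma coef_normalise v i :
  coef (run_prog (normalise v)) i =
  coef v i / Num.sqrt (run_prog (dot v v)).
Proof.
rewrite /normalise run_bind /= run_bind run_map_prog /= /coef /=.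
case: ltnP => _; first by rewrite mul0r.
case: (ltnP (i - start v) (size (entries v))) => lti.
  by rewrite (nth_map 0).
by rewrite !nth_default ?size_map // mul0r.
Qed.

Lemma count_dot u v : (op_count (dot u v) <= size (entries u) * 2)%N.
Proof.
rewrite -(size_iota (start u) (size (entries u))).
exact: count_fold_prog.
Qed.

(** Each of the at most size + 2b entries is a sum over the indices at distance
    at most b, of which there are at most 2b + 1. *)
Lemma count_band_mul b M v :
  (op_count (band_mul b M v)
   <= (size (entries v) + 2 * b) * ((2 * b).+1 * 2))%N.
Proof.
rewrite /band_mul count_bind /= addn0.
set n := (_ + b - _)%N.
have le_n : (n <= size (entries v) + 2 * b)%N by rewrite /n; lia.
apply: leq_trans (leq_mul le_n (leqnn _)).
rewrite -{2}(size_iota (start v - b) n).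
apply: (@count_map_prog R _ _ predT) => [i _|]; last exact: all_predT.
apply: leq_trans (count_fold_prog (c := 2) _ _ _) _ => //.
rewrite leq_mul2r /=.
rewrite -(size_iota (i - b) (2 * b).+1) uniq_leq_size //.
  by rewrite filter_uniq // iota_uniq.
by move=> j; rewrite mem_filter !mem_iota; lia.
Qed.

Definition fits (W : nat) : pred (bvec R) :=
  fun v => (size (entries v) <= W)%N.

Lemma count_subtract W win us g : all (fits W) us ->
  (op_count (subtract_components win us g)
   <= size us * (W * 2) + win.2 * (size us * 2))%N.
Proof.
move=> usW; rewrite /subtract_components !count_bind /= addn0 leq_add //.
  apply: (@count_map_prog _ _ _ (fits W)) => // u uW.
  by apply: leq_trans (count_dot _ _) _; rewrite leq_mul2r.
rewrite -{2}(size_iota win.1 win.2).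
apply: (@count_map_prog R _ _ predT) => [i _|]; last exact: all_predT.
apply: leq_trans (count_fold_prog (c := 2) _ _ _) _ => //.
by rewrite leq_mul2r size_zip geq_minr.
Qed.

Lemma size_subtract win us g :
  size (entries (run_prog (subtract_components win us g))) = win.2.
Proof.
by rewrite /subtract_components !run_bind run_map_prog /= size_map size_iota.
Qed.

Lemma count_normalise v :
  (op_count (normalise v) <= size (entries v) * 3 + 1)%N.
Proof.
rewrite /normalise count_bind /= count_bind /= addn0.
set p := map_prog _ _.
have cp : (op_count p <= size (entries v) * 1)%N.
  by apply: (@count_map_prog R _ _ predT); rewrite ?all_predT.
have := count_dot v v; lia.
Qed.

Lemma size_normalise v :
  size (entries (run_prog (normalise v))) = size (entries v).
Proof. by rewrite /normalise run_bind /= run_bind run_map_prog /= size_map. Qed.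

End VectorPrograms.

(** * Integration of polynomials against the weight *)

Section PolyIntegral.
Context {R : realType} (I : set R) (w : R -> R).
Hypothesis wI : is_weight I w.

Lemma measurable_support : measurable I.
Proof.
by case: (weight_interval wI) => [[a [b [_ ->]]]|[[a ->]|->]].
Qed.

Lemma integrable_poly (p : {poly R}) :
  lebesgue_measure.-integrable I (EFin \o (fun t => p.[t] * w t)).
Proof.
have -> : EFin \o (fun t => p.[t] * w t)
    = fun t => (\sum_(i < size p) (p`_i)%:E * (t ^+ i * w t)%:E)%E.
  apply/funext => t /=; rewrite horner_coef mulr_suml -sumEFin.
  by apply: eq_bigr => i _; rewrite -EFinM mulrA.
apply: integrable_sum => [|i _]; first exact: measurable_support.
by apply: integrableZl; [exact: measurable_support|exact: weight_moments].
Qed.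

Definition poly_integral (p : {poly R}) : R :=
  Rintegral lebesgue_measure I (fun t => p.[t] * w t).

Lemma poly_integral_linear c (p q : {poly R}) :
  poly_integral (c *: p + q) = c * poly_integral p + poly_integral q.
Proof.
have mI := measurable_support.
rewrite /poly_integral -RintegralZl ?integrable_poly // -RintegralD //;
  last 2 first.
- have := integrable_poly (c *: p); congr integrable; apply/funext => t /=.
  by rewrite hornerZ mulrA.
- exact: integrable_poly.
by apply: eq_Rintegral => t _ /=; rewrite hornerD hornerZ mulrDl mulrA.
Qed.

End PolyIntegral.

(** * The ring of polynomials on the curve *)

Section CurveRing.
Context {R : realType} (m : nat) (phi : {poly R}).
Hypothesis m_gt0 : (0 < m)%N.
Local Notation E := (curve_ring m phi).
Implicit Types (f g h : E) (p q : {poly R}) (c : R).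

Lemma mk_monic_curve : mk_monic (curve_eqn m phi) = curve_eqn m phi.
Proof.
by rewrite /mk_monic /curve_eqn size_XnsubC // monicXnsubC // ltnS m_gt0.
Qed.

Lemma size_mk_monic_curve : size (mk_monic (curve_eqn m phi)) = m.+1.
Proof. by rewrite mk_monic_curve size_XnsubC. Qed.

Lemma size_curve f : (size (f : {poly {poly R}}) <= m)%N.
Proof. by rewrite -ltnS -size_mk_monic_curve; exact: size_mk_monic. Qed.

(** The remainder modulo y^m - phi(x) takes the same values on the curve, which
    makes evaluation at a point of the curve multiplicative. *)
Lemma curve_eval_in (p : {poly {poly R}}) t s : s ^+ m = phi.[t] ->
  curve_eval (in_qpoly (curve_eqn m phi) p : E) t s = p.[s%:P].[t].
Proof.
move=> ct; rewrite /curve_eval /= mk_monic_curve.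
have mon : curve_eqn m phi \is monic by exact: monicXnsubC.
rewrite {2}(Pdiv.RingMonic.rdivp_eq mon p) !hornerE /curve_eqn.
by rewrite ct subrr mulr0 add0r.
Qed.

Lemma curve_evalM f g t s : s ^+ m = phi.[t] ->
  curve_eval (f * g) t s = curve_eval f t s * curve_eval g t s.
Proof. by move=> ct; rewrite /= curve_eval_in // !hornerM. Qed.

Lemma xpolyM p q : xpoly m phi (p * q) = xpoly m phi p * xpoly m phi q.
Proof. by rewrite /xpoly polyCM rmorphM. Qed.

Lemma xpoly_linear c p q :
  xpoly m phi (c *: p + q) = curve_scale c (xpoly m phi p) + xpoly m phi q.
Proof.
by rewrite /xpoly polyCD -mul_polyC polyCM mul_polyC in_qpolyD in_qpolyZ.
Qed.

Lemma curve_yX : curve_y m phi ^+ m = xpoly m phi phi.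
Proof.
rewrite /curve_y /xpoly -rmorphXn; apply/eqP; rewrite -subr_eq0 -raddfB.
have mon : curve_eqn m phi \is monic by exact: monicXnsubC.
have h0 : in_qpoly (curve_eqn m phi) (curve_eqn m phi) = 0.
  by apply/val_inj; rewrite /= mk_monic_curve Pdiv.RingMonic.rmodpp.
exact/eqP/h0.
Qed.

Lemma coef_xpoly p i :
  (xpoly m phi p : {poly {poly R}})`_i = if i == 0%N then p else 0.
Proof.
rewrite in_qpoly_small ?coefC // size_mk_monic_curve ltnS.
by rewrite (leq_trans (size_polyC_leq1 _)).
Qed.

Lemma coef_curve_scale c f i :
  (curve_scale c f : {poly {poly R}})`_i = c *: (f : {poly {poly R}})`_i.
Proof. by rewrite /= coefZ mul_polyC. Qed.

Lemma curve_scale1 f : curve_scale 1 f = f.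
Proof. by rewrite /curve_scale scale1r. Qed.

Lemma curve_scale0 f : curve_scale 0 f = 0.
Proof. by rewrite /curve_scale scale0r. Qed.

Lemma curve_scaler0 c : curve_scale c (0 : E) = 0.
Proof. by rewrite /curve_scale scaler0. Qed.

Lemma curve_scaleA a c f :
  curve_scale a (curve_scale c f) = curve_scale (a * c) f.
Proof. by rewrite /curve_scale scalerA polyCM. Qed.

Lemma curve_scaleN f : curve_scale (- 1) f = - f.
Proof. by rewrite /curve_scale polyCN scaleN1r. Qed.

Lemma curve_scaleAr c f g : f * curve_scale c g = curve_scale c (f * g).
Proof. by rewrite /curve_scale scalerAr. Qed.

End CurveRing.

Lemma coef_curve_y_xpoly (R : realType) (phi q : {poly R}) i :
  (curve_y 2 phi * xpoly 2 phi q : {poly {poly R}})`_i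
  = if i == 1%N then q else 0.
Proof.
rewrite -in_qpolyM in_qpoly_small.
  by rewrite mulrC coefMX coefC; case: i => [|[]].
rewrite size_mk_monic_curve // ltnS (leq_trans (size_polyMleq _ _)) //.
by rewrite size_polyX /= ltnS size_polyC_leq1.
Qed.

(** For m = 1 the second summand is zero. *)
Lemma curve_decomp (R : realType) m (phi : {poly R}) (f : curve_ring m phi) :
  m = 1%N \/ m = 2%N ->
  f = xpoly m phi (f : {poly {poly R}})`_0
      + curve_y m phi * xpoly m phi (f : {poly {poly R}})`_1.
Proof.
case=> mE; subst m.
  have f1 i : (0 < i)%N -> (f : {poly {poly R}})`_i = 0.
    by move=> i0; rewrite nth_default //; apply: leq_trans (size_curve _ f) _.
  rewrite (f1 1%N) // [X in _ * X](_ : _ = 0) ?mulr0 ?addr0; last first.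
    by rewrite /xpoly polyC0 raddf0.
  apply/val_inj/polyP => i; rewrite [RHS]coef_xpoly //.
  by case: eqP => [->//|/eqP]; rewrite -lt0n => /f1.
apply/val_inj/polyP => i; rewrite [RHS]coefD coef_xpoly // coef_curve_y_xpoly.
case: i => [|[|i]] /=; rewrite ?addr0 ?add0r //.
by rewrite nth_default // (leq_trans (size_curve _ f)).
Qed.

(** * Real subspaces *)

Section Subspaces.
Context {R : realType} (m : nat) (phi : {poly R}).
Local Notation E := (curve_ring m phi).
Implicit Types (f g h : E) (c : R) (U : E -> Prop).

(** The quotient ring is a module over R[x], whereas spans and orthogonality are
    meant over R. *)
Definition curve_subspace U : Prop :=
  U 0 /\ forall c f g, U f -> U g -> U (curve_scale c f + g).

(** As the intersection of all subspaces containing G, so that an inclusion is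
    proved by checking generators only. *)
Definition curve_span (G : E -> Prop) : E -> Prop :=
  fun f => forall U, curve_subspace U -> (forall h, G h -> U h) -> U f.

Lemma subspaceZ U c f : curve_subspace U -> U f -> U (curve_scale c f).
Proof. by case=> U0 Ul Uf; rewrite -[curve_scale c f]addr0; apply: Ul. Qed.

Lemma subspaceD U f g : curve_subspace U -> U f -> U g -> U (f + g).
Proof. by case=> U0 Ul Uf Ug; rewrite -(curve_scale1 f); apply: Ul. Qed.

Lemma subspaceN U f : curve_subspace U -> U f -> U (- f).
Proof. by move=> sU Uf; rewrite -curve_scaleN; apply: subspaceZ. Qed.

Lemma subspace_sum U (s : seq E) (F : E -> E) : curve_subspace U ->
  (forall a, a \in s -> U (F a)) -> U (\sum_(a <- s) F a).
Proof.
move=> sU; elim: s => [|a s IH] UF; first by rewrite big_nil; case: sU.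
rewrite big_cons; apply: subspaceD => //; first by apply: UF; rewrite mem_head.
by apply: IH => b bs; apply: UF; rewrite inE bs orbT.
Qed.

Lemma subspace_curve_span G : curve_subspace (curve_span G).
Proof.
split=> [U [] //|c f g sf sg U sU GU].
by case: (sU) => _; apply; [apply: sf|apply: sg].
Qed.

Lemma mem_curve_span (G : E -> Prop) h : G h -> curve_span G h.
Proof. by move=> Gh U _; apply. Qed.

Lemma subspace_mul U h :
  curve_subspace U -> curve_subspace (fun f => U (h * f)).
Proof.
case=> U0 Ul; split=> [|c f g Uf Ug]; first by rewrite mulr0.
by rewrite mulrDr curve_scaleAr; apply: Ul.
Qed.

(** Cancel the top coefficient with the last b_n and induct. *)
Lemma poly_subspace (U : {poly R} -> Prop) (b : nat -> {poly R}) K :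
  U 0 -> (forall c p q, U p -> U q -> U (c *: p + q)) ->
  (forall n, size (b n) = n.+1) -> (forall n, (n < K)%N -> U (b n)) ->
  forall p : {poly R}, (size p <= K)%N -> U p.
Proof.
move=> U0 Ul sb; elim: K => [|K IH] Ub p sp.
  by move: sp; rewrite size_poly_leq0 => /eqP->.
pose c := p`_K / lead_coef (b K).
have lb : (b K)`_K != 0.
  have := lead_coef_eq0 (b K).
  by rewrite lead_coefE sb /= -size_poly_eq0 sb => ->.
rewrite -[p](subrK (c *: b K)) addrC; apply: Ul; first exact: Ub.
apply: IH => [n nK|]; first by apply: Ub; rewrite ltnS ltnW.
apply/leq_sizeP => j; rewrite leq_eqVlt => /predU1P[<-|Kj].
  by rewrite coefB coefZ /c lead_coefE sb /= divfK ?subrr.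
by rewrite coefB coefZ !nth_default ?mulr0 ?subrr ?sb //; apply: leq_trans sp _.
Qed.

Lemma subspace_mul_xpoly U h (b : nat -> {poly R}) K : curve_subspace U ->
  (forall n, size (b n) = n.+1) ->
  (forall n, (n < K)%N -> U (h * xpoly m phi (b n))) ->
  forall p : {poly R}, (size p <= K)%N -> U (h * xpoly m phi p).
Proof.
move=> sU sb Ub; apply: (poly_subspace (b := b)) => // [|c p q Up Uq].
  by rewrite /xpoly polyC0 raddf0 mulr0; case: sU.
by rewrite xpoly_linear; case: (subspace_mul h sU) => _; apply.
Qed.

End Subspaces.

(** * Storage scheme *)

(** An OP of degree n has its coefficients between d (n - d) and d n; the
    truncated subtraction makes the window start at 0 for n < d.  Multiplication
    by x or y moves the index by at most 2d in all cases. *)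
Definition curve_storage (d : nat) : storage :=
  Storage (fun n => (d * (n - d), d * d + 1)%N) (2 * d) (2 * d).

Lemma size_candidates (A B : Type) d n (f g : A -> B) (s : seq A) :
  (2 < d)%N -> size s = minn n.+1 d ->
  size (candidates d n f g s) = minn n.+2 d.
Proof.
move=> d_gt2 sn; rewrite /candidates; case: ltnP => nd.
  by rewrite size_cat !size_map size_drop sn; lia.
by rewrite size_map sn; lia.
Qed.

#[local] Arguments next_op : simpl never.
#[local] Arguments jacobi_blocks : simpl never.

(** * The inner product on the curve *)

Section LanczosOnCurve.
Context {R : realType} (m d : nat) (phi : {poly R}) (I : set R) (w : R -> R).
Hypothesis m12 : m = 1%N \/ m = 2%N.
Hypothesis wI : is_weight I w.
Hypothesis phi_gt0 : m = 2%N -> forall t, I t -> 0 < phi.[t].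
Local Notation E := (curve_ring m phi).
Local Notation ip := (@curve_ip R m phi I w).
Local Notation coordy f i := ((f : {poly {poly R}})`_i).
Local Notation x := (curve_x m phi).
Local Notation y := (curve_y m phi).
Local Notation xp := (xpoly m phi).
Implicit Types (f g h : E) (c : R).

Let m_gt0 : (0 < m)%N. Proof. by case: m12 => ->. Qed.

Lemma branches_on_curve t s : I t -> s \in branches m phi t -> s ^+ m = phi.[t].
Proof.
move=> It; rewrite /branches; case: m12 => mE; rewrite mE /= !inE.
  by move=> /eqP->.
have phi_ge0 : 0 <= phi.[t] by exact/ltW/phi_gt0.
by move=> /orP[]/eqP->; rewrite ?sqrrN sqr_sqrtr.
Qed.

(** For m = 2 the odd powers of y cancel between the two branches, and
    y^2 = phi; for m = 1 the coefficient of y is zero.  In both cases the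
    integrand is this polynomial times the weight, which gives
    integrability. *)
Definition ip_density f g : {poly R} :=
  m%:R *: (coordy f 0 * coordy g 0 + phi * (coordy f 1 * coordy g 1)).

Lemma curve_evalE f t s :
  curve_eval f t s = (coordy f 0).[t] + (coordy f 1).[t] * s.
Proof.
rewrite /curve_eval (@horner_coef_wide _ 2 (f : {poly {poly R}})); last first.
  by apply: leq_trans (size_curve m_gt0 f) _; case: m12 => ->.
by rewrite !big_ord_recr big_ord0 /= add0r expr0 expr1 mulr1 !hornerE.
Qed.

Lemma ip_densityE f g t : I t ->
  \sum_(s <- branches m phi t) curve_eval f t s * curve_eval g t s
  = (ip_density f g).[t].
Proof.
move=> It; under eq_bigr => s _ do rewrite !curve_evalE.
rewrite /ip_density /branches; case: m12 => mE.
  have cf h : coordy h 1 = 0.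
    rewrite nth_default //; apply: leq_trans (size_curve m_gt0 h) _.
    by rewrite mE.
  rewrite !cf; move: (coordy f 0) (coordy g 0) => a b.
  by rewrite mE /= big_seq1 !hornerE /=; ring.
have sphi : Num.sqrt phi.[t] ^+ 2 = phi.[t].
  by rewrite sqr_sqrtr // ltW ?phi_gt0.
move: (coordy f 0) (coordy g 0) (coordy f 1) (coordy g 1) => a b a' b'.
rewrite mE /= !big_cons big_nil !hornerE /=.
by move: (Num.sqrt phi.[t]) sphi => r <-; ring.
Qed.

Lemma ip_poly_integral f g : ip f g = poly_integral I w (ip_density f g).
Proof.
by apply: eq_Rintegral => t; rewrite inE => It; rewrite ip_densityE.
Qed.

Lemma ipC f g : ip f g = ip g f.
Proof.
rewrite !ip_poly_integral /ip_density; congr (poly_integral _ _ _).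
by rewrite ![coordy f _ * _]mulrC.
Qed.

Lemma ip_linear c f g h : ip (curve_scale c f + g) h = c * ip f h + ip g h.
Proof.
rewrite !ip_poly_integral -poly_integral_linear //; congr (poly_integral _ _ _).
rewrite /ip_density !coefD !coef_curve_scale -!mul_polyC; ring.
Qed.

(** Multiplication operators are self-adjoint. *)
Lemma ip_mul h f g : ip (h * f) g = ip f (h * g).
Proof.
apply: eq_Rintegral => t; rewrite inE => It; congr (_ * _).
rewrite big_seq [RHS]big_seq; apply: eq_bigr => s /(branches_on_curve It) sE.
by rewrite !curve_evalM // mulrA (mulrC (curve_eval h t s)).
Qed.

Lemma ip0l h : ip 0 h = 0.
Proof.
have /eqP := ip_linear 1 0 0 h; rewrite curve_scaler0 addr0 mul1r.
by rewrite -subr_eq0 opprD addrA subrr sub0r oppr_eq0 => /eqP.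
Qed.

Lemma ipZl c f h : ip (curve_scale c f) h = c * ip f h.
Proof. by have := ip_linear c f 0 h; rewrite addr0 ip0l addr0. Qed.

Lemma ipDl f g h : ip (f + g) h = ip f h + ip g h.
Proof. by rewrite -{1}(curve_scale1 f) ip_linear mul1r. Qed.

Lemma ipNl f h : ip (- f) h = - ip f h.
Proof. by rewrite -curve_scaleN ipZl mulN1r. Qed.

Lemma ip_suml A (s : seq A) (F : A -> E) h :
  ip (\sum_(a <- s) F a) h = \sum_(a <- s) ip (F a) h.
Proof.
elim: s => [|a s IH]; first by rewrite !big_nil ip0l.
by rewrite !big_cons ipDl IH.
Qed.

(** * The P-basis *)

Context (p q : nat -> {poly R}).
Hypothesis pO : is_orthonormal_polys I w p.
Hypothesis qO : m = 2%N -> is_orthonormal_polys I (fun t => phi.[t] * w t) q.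
Local Notation P := (pbasis m phi p q).

Lemma pbasis_orthonormal i j : ip (P i) (P j) = (i == j)%:R.
Proof.
have pp k l : poly_integral I w (p k * p l) = (k == l)%:R.
  by rewrite -(op_ortho pO); apply: eq_Rintegral => t _; rewrite hornerM.
rewrite ip_poly_integral /pbasis /ip_density.
case: m12 => mE; move: qO; rewrite mE /= => qO'.
  by rewrite !coef_xpoly //= scale1r mulr0 mulr0 addr0.
have {}qO' := qO' erefl.
have qq k l : poly_integral I w (phi * (q k * q l)) = (k == l)%:R.
  rewrite -(op_ortho qO'); apply: eq_Rintegral => t _.
  by rewrite !hornerM; ring.
have z0 : poly_integral I w 0 = 0.
  by rewrite /poly_integral; under eq_Rintegral do rewrite horner0 mul0r;
     rewrite /Rintegral integral0.
have piZ c r : poly_integral I w (c *: r) = c * poly_integral I w r.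
  by rewrite -[c *: r]addr0 poly_integral_linear // z0 addr0.
have s2 : 2 * ((Num.sqrt 2)^-1 * (Num.sqrt 2)^-1) = 1 :> R.
  by rewrite -invfM -expr2 sqr_sqrtr // divff.
have half (r : {poly R}) : 2 *: ((Num.sqrt 2)^-1 *: ((Num.sqrt 2)^-1 *: r)) = r.
  by rewrite !scalerA -mulrA s2 scale1r.
case: ifPn => oi; case: ifPn => oj;
  rewrite !coef_curve_scale ?coef_xpoly ?coef_curve_y_xpoly //=;
  rewrite -?scalerAl -?scalerAr ?scaler0 ?(mulr0, mul0r, addr0, add0r, scaler0).
- rewrite half pp; congr (nat_of_bool _)%:R; lia.
- rewrite z0; have -> : (i == j) = false by lia. by [].
- rewrite z0; have -> : (i == j) = false by lia. by [].
- rewrite half qq; congr (nat_of_bool _)%:R; lia.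
Qed.

Lemma subspace_orthogonal g : curve_subspace (fun f => ip f g = 0).
Proof.
split=> [|c f h fg hg]; first exact: ip0l.
by rewrite ip_linear // fg hg mulr0 addr0.
Qed.

(** Membership in the span of P_0, ..., P_(K-1), stated through the
    coordinates. *)
Definition in_first K f : Prop :=
  f = \sum_(i <- iota 0 K) curve_scale (ip f (P i)) (P i).

Lemma ip_comb (s : seq nat) (a : nat -> R) j : uniq s ->
  ip (\sum_(i <- s) curve_scale (a i) (P i)) (P j) = if j \in s then a j else 0.
Proof.
move=> us; rewrite ip_suml //.
under eq_bigr => i _ do rewrite ipZl // pbasis_orthonormal.
elim: s us => [|i s IH] /=; first by rewrite big_nil.
move=> /andP[nis us]; rewrite big_cons inE IH // eq_sym.
case: eqP => [->|_] /=; last by rewrite mulr0 add0r.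
by rewrite (negPf nis) mulr1 addr0.
Qed.

Lemma in_first_coef K f i : in_first K f -> (K <= i)%N -> ip f (P i) = 0.
Proof.
by move=> -> Ki; rewrite ip_comb ?iota_uniq // mem_iota ltnNge Ki andbF.
Qed.

Lemma subspace_in_first K : curve_subspace (in_first K).
Proof.
split=> [|c f g fK gK]; rewrite /in_first.
  by rewrite big1 // => i _; rewrite ip0l // curve_scale0.
rewrite {1}fK {1}gK /curve_scale scaler_sumr -big_split /=.
apply: eq_bigr => i _; rewrite ip_linear // polyCD scalerDl polyCM.
by rewrite scalerA.
Qed.

Lemma in_first_basis K i : (i < K)%N -> in_first K (P i).
Proof.
move=> iK; rewrite /in_first (bigD1_seq i) ?iota_uniq ?mem_iota //=.
rewrite pbasis_orthonormal eqxx curve_scale1 big1 ?addr0 // => j.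
by rewrite pbasis_orthonormal eq_sym => /negPf->; rewrite curve_scale0.
Qed.

Lemma in_first_le K K' f : (K <= K')%N -> in_first K f -> in_first K' f.
Proof.
move=> KK' fK; rewrite /in_first {1}fK -(subnKC KK') iotaD big_cat /= add0n.
rewrite [X in _ + X]big_seq [X in _ + X]big1 ?addr0 // => i.
by rewrite mem_iota => /andP[Ki _]; rewrite (in_first_coef fK) // curve_scale0.
Qed.

(** For m = 2, p_k sits at index 2k - 1 (at 0 for k = 0) and y q_k at index
    2k + 2. *)
Lemma in_first_xpoly e (r : {poly R}) :
  (size r <= e.+1)%N -> in_first (m * e).+1 (xp r).
Proof.
move=> sr; rewrite -[xp r]mul1r.
apply: (subspace_mul_xpoly (b := p) _ _ _ sr) => [||n ne].
- exact: subspace_in_first.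
- exact: op_size pO.
rewrite mul1r; have [i [c [-> ile]]] : exists i c,
    xp (p n) = curve_scale c (P i) /\ (i <= m * n)%N.
  case: m12 => mE; first by exists n, 1; rewrite curve_scale1 /pbasis mE mul1n.
  exists n.*2.-1, (Num.sqrt 2); rewrite /pbasis mE /=; split; last by lia.
  rewrite ifT; last by lia.
  rewrite curve_scaleA divff ?sqrtr_eq0 -?ltNge // curve_scale1.
  congr (xpoly _ _ (p _)); lia.
apply: subspaceZ; first exact: subspace_in_first.
apply: in_first_basis.
by rewrite ltnS (leq_trans ile) // leq_mul2l -ltnS ne orbT.
Qed.

Lemma in_first_y_xpoly e (r : {poly R}) : m = 2%N ->
  (size r <= e.+1)%N -> in_first (e.+1.*2).+1 (y * xp r).
Proof.
move=> mE sr; have qs := op_size (qO mE).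
apply: (subspace_mul_xpoly (b := q) _ _ _ sr) => // [|n ne].
  exact: subspace_in_first.
have -> : y * xp (q n) = curve_scale (Num.sqrt 2) (P n.+1.*2).
  rewrite /pbasis mE /= ifF; last by lia.
  rewrite curve_scaleA divff ?sqrtr_eq0 -?ltNge // curve_scale1.
  congr (_ * xpoly _ _ (q _)); lia.
apply: subspaceZ; first exact: subspace_in_first.
by apply: in_first_basis; lia.
Qed.

Lemma curve1_y : m = 1%N -> y = xp phi.
Proof. by move=> mE; have := curve_yX phi m_gt0; rewrite [X in _ ^+ X]mE. Qed.

Lemma basis_complete f : exists K, in_first K f.
Proof.
rewrite (curve_decomp f m12).
move: (polyn f)`_0 (polyn f)`_1 => a b.
case: m12 => mE.
  rewrite curve1_y // -xpolyM -[xp a]curve_scale1 -xpoly_linear.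
  by eexists; apply: in_first_xpoly; exact: leqnSn.
exists (m * size a + (size b).+1.*2).+1.
apply: subspaceD; first exact: subspace_in_first.
  by apply: in_first_le (in_first_xpoly (leqnSn _)); lia.
by apply: in_first_le (in_first_y_xpoly mE (leqnSn _)); lia.
Qed.

(** All identities between a coefficient vector and a polynomial are reduced to
    coordinates by this lemma. *)
Lemma basis_ext f g : (forall i, ip f (P i) = ip g (P i)) -> f = g.
Proof.
have [K fK] := basis_complete f; have [K' gK] := basis_complete g => fg.
rewrite (in_first_le (leq_maxl K K') fK) (in_first_le (leq_maxr K K') gK).
by apply: eq_bigr => i _; rewrite fg.
Qed.

Lemma ip_parseval K f g : in_first K f ->
  ip f g = \sum_(i <- iota 0 K) ip f (P i) * ip g (P i).
Proof.
move=> fK; rewrite {1}fK ip_suml //; apply: eq_bigr => i _.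
by rewrite ipZl // [ip (P i) g]ipC.
Qed.

Lemma ip_ge0 f : 0 <= ip f f.
Proof.
have [K fK] := basis_complete f; rewrite (ip_parseval _ fK).
by apply: sumr_ge0 => i _; rewrite -expr2 sqr_ge0.
Qed.

Lemma ip_eq0 f : ip f f = 0 -> f = 0.
Proof.
have [K fK] := basis_complete f; rewrite (ip_parseval _ fK) => /eqP.
rewrite psumr_eq0 => [/allP f0|i _]; last by rewrite -expr2 sqr_ge0.
apply: basis_ext => i; rewrite ip0l //.
have [iK|Ki] := ltnP i K; last exact: in_first_coef fK Ki.
by have := f0 i; rewrite mem_iota /= iK mulf_eq0 orbb => /(_ isT)/eqP.
Qed.

Lemma is_coordsP f a : is_coords P f a -> forall i, a i = ip f (P i).
Proof.
case=> K aK -> i.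
rewrite -(big_mkord xpredT (fun i => curve_scale (a i) (P i))).
rewrite ip_comb ?iota_uniq // mem_index_iota /=.
by case: ltnP => // /aK.
Qed.

Lemma is_coordsE f a : (forall i, a i = ip f (P i)) -> is_coords P f a.
Proof.
have [K fK] := basis_complete f => af; exists K => [i Ki|].
  by rewrite af; exact: in_first_coef Ki.
rewrite {1}fK -(big_mkord xpredT (fun i => curve_scale (a i) (P i))).
by rewrite /index_iota subn0; apply: eq_bigr => i _; rewrite af.
Qed.

Hypothesis size_phi : size phi = d.+1.
Hypothesis d_gt2 : (2 < d)%N.

(** The extreme case is y P_j with m = 2 and j = 2k even: phi q_(k-1) has degree
    d + k - 1, hence index j + 2d - 3. *)
Lemma in_first_mul_basis z j : z = x \/ z = y ->
  in_first (j + 2 * d).+1 (z * P j).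
Proof.
have sX (r : {poly R}) n : (size r <= n)%N -> (size ('X * r)%R <= n.+1)%N.
  move=> sr; apply: leq_trans (size_polyMleq _ _) _.
  by rewrite size_polyX.
have sphi (r : {poly R}) n : (size r <= n)%N -> (size (phi * r)%R <= d + n)%N.
  move=> sr; apply: leq_trans (size_polyMleq _ _) _.
  by rewrite size_phi addSn leq_add2l.
have ps k : (size (p k) <= k.+1)%N by rewrite (op_size pO).
have sF := subspace_in_first.
case: m12 => mE zE.
  rewrite /pbasis [in X in if X then _ else _]mE /=; case: zE => ->.
    rewrite -xpolyM; apply: in_first_le (in_first_xpoly (sX _ _ (ps j))).
    by rewrite mE; lia.
  rewrite curve1_y // -xpolyM.
  apply: (@in_first_le (m * (d + j)).+1); first by rewrite mE; lia.
  by apply: in_first_xpoly; rewrite -addnS; apply: sphi.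
have qs k : (size (q k) <= k.+1)%N by rewrite (op_size (qO mE)).
rewrite /pbasis [in X in if X then _ else _]mE /=.
case: ifP => jE; rewrite curve_scaleAr; apply: subspaceZ => //.
  case: zE => ->.
    rewrite -xpolyM; apply: in_first_le (in_first_xpoly (sX _ _ (ps _))).
    by rewrite mE; lia.
  by apply: in_first_le (in_first_y_xpoly mE (ps _)); lia.
case: zE => ->.
  rewrite mulrCA -xpolyM.
  by apply: in_first_le (in_first_y_xpoly mE (sX _ _ (qs _))); lia.
rewrite mulrA -expr2 -[X in _ ^+ X]mE curve_yX // -xpolyM.
apply: (@in_first_le (m * (d + (j./2).-1)).+1); first by rewrite mE; lia.
by apply: in_first_xpoly; rewrite -addnS; apply: sphi.
Qed.

Lemma mult_matrix_coef z M : is_mult_matrix P z M ->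
  forall i j, M i j = ip (z * P j) (P i).
Proof. by move=> zM i j; apply: is_coordsP (zM j) i. Qed.

(** Entries above the band vanish by symmetry. *)
Lemma mult_matrix_banded z M : z = x \/ z = y -> is_mult_matrix P z M ->
  forall i j, (j + 2 * d < i)%N || (i + 2 * d < j)%N -> M i j = 0.
Proof.
move=> zE zM i j; rewrite (mult_matrix_coef zM) => /orP[ij|ij].
  exact: in_first_coef (in_first_mul_basis j zE) ij.
rewrite ip_mul // ipC //; exact: in_first_coef (in_first_mul_basis i zE) ij.
Qed.

(** * Total degree and coefficient windows *)

Definition Pi (n : nat) : E -> Prop :=
  curve_span (fun f => exists i j, (i + j <= n)%N /\ f = xp 'X^i * y ^+ j).

Lemma subspace_Pi n : curve_subspace (Pi n).
Proof. exact: subspace_curve_span. Qed.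

Lemma Pi_le n n' f : (n <= n')%N -> Pi n f -> Pi n' f.
Proof.
move=> nn'; apply; first exact: subspace_Pi.
move=> h [i [j [ij ->]]]; apply: mem_curve_span; exists i, j; split=> //.
exact: leq_trans nn'.
Qed.

Lemma Pi_mulx n f : Pi n f -> Pi n.+1 (x * f).
Proof.
move=> fPi; apply: (fPi (fun f => Pi n.+1 (x * f))).
  exact/subspace_mul/subspace_Pi.
move=> h [i [j [ij ->]]]; apply: mem_curve_span; exists i.+1, j; split=> //.
by rewrite mulrA -xpolyM exprS.
Qed.

Lemma Pi_muly n f : Pi n f -> Pi n.+1 (y * f).
Proof.
move=> fPi; apply: (fPi (fun f => Pi n.+1 (y * f))).
  exact/subspace_mul/subspace_Pi.
move=> h [i [j [ij ->]]]; apply: mem_curve_span; exists i, j.+1; split.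
  by rewrite addnS.
by rewrite mulrCA exprS.
Qed.

Lemma Pi_mulyX n k f : Pi n f -> Pi (n + k) (y ^+ k * f).
Proof.
move=> nf; elim: k => [|k IH]; first by rewrite addn0 mul1r.
by rewrite addnS exprS -mulrA; apply: Pi_muly.
Qed.

Lemma Pi_xpoly n (r : {poly R}) : (size r <= n.+1)%N -> Pi n (xp r).
Proof.
move=> sr; rewrite -[xp r]mul1r.
apply: (subspace_mul_xpoly (b := fun k => 'X^k) _ _ _ sr) => [||k kn].
- exact: subspace_Pi.
- by move=> k; rewrite size_polyXn.
by apply: mem_curve_span; exists k, 0%N; rewrite addn0 mul1r mulr1.
Qed.

(** Division by phi trades m powers of y for d powers of x. *)
Lemma xpoly_divp (r : {poly R}) :
  xp r = y ^+ m * xp (r %/ phi) + xp (r %% phi).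
Proof.
rewrite curve_yX // -xpolyM {1}(divp_eq r phi) mulrC.
by rewrite -[xp (_ * _)]curve_scale1 -xpoly_linear scale1r.
Qed.

Lemma size_divphi (r : {poly R}) n :
  (size r <= d + n)%N -> (size (r %/ phi)%R <= n)%N.
Proof.
by move=> sr; rewrite size_divp -?size_poly_eq0 size_phi //= leq_subLR.
Qed.

Lemma size_modphi (r : {poly R}) : (size (r %% phi)%R <= d)%N.
Proof. by rewrite -ltnS -size_phi ltn_modp -size_poly_eq0 size_phi. Qed.

(** Write r in base phi: r = sum of r_l phi^l with deg r_l < d and l <= k; the
    term r_l y^(m l) has total degree at most d - 1 + m k. *)
Lemma Pi_xpoly_high k (r : {poly R}) :
  (size r <= d * k.+1)%N -> Pi (d.-1 + m * k) (xp r).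
Proof.
elim: k r => [|k IH] r sr.
  by rewrite muln0 addn0; apply: Pi_xpoly; rewrite prednK; lia.
rewrite xpoly_divp; apply: (subspaceD (subspace_Pi _)).
  rewrite mulnS addnCA addnC; apply: Pi_mulyX; apply: IH.
  by apply: size_divphi; rewrite -mulnS.
apply: (@Pi_le d.-1); first exact: leq_addr.
by apply: Pi_xpoly; rewrite prednK ?size_modphi; lia.
Qed.

(** For m = 2 the number k of divisions differs with the parity in y: it is
    (n+1-d)/2 for p and (n-d)/2 for y q, which has one more factor y. *)
Lemma Pi_basis n i : (i < d * (n.+1 - d))%N -> Pi n (P i).
Proof.
move=> iS; have ps := op_size pO.
have dn : (d <= n)%N by case: (leqP d n) => // nd; move: iS; nia.
rewrite /pbasis; case: m12 => mE; rewrite [in X in if X then _ else _]mE /=.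
  apply: (@Pi_le (d.-1 + m * (n.+1 - d).-1)); first by rewrite mE; lia.
  by apply: Pi_xpoly_high; rewrite ps prednK //; lia.
case: ifP => iE; apply: (subspaceZ _ (subspace_Pi _)).
  apply: (@Pi_le (d.-1 + m * (n.+1 - d)./2)); first by rewrite mE; lia.
  by apply: Pi_xpoly_high; rewrite ps; nia.
apply: (@Pi_le (d.-1 + m * (n - d)./2).+1); first by rewrite mE; lia.
apply: Pi_muly; apply: Pi_xpoly_high; rewrite (op_size (qO mE)).
move: iS; rewrite subSn //; nia.
Qed.

Lemma size_exp_le (r : {poly R}) k :
  (size (r ^+ k)%R <= ((size r).-1 * k).+1)%N.
Proof. by rewrite -size_exp leqSpred. Qed.

(** x^i y^j becomes x^i phi^j for m = 1, and x^i phi^(j/2) y^(j mod 2) for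
    m = 2, where indices count the degree in x twice. *)
Lemma Pi_in_first n f : Pi n f -> in_first (d * n).+1 f.
Proof.
have sF K := subspace_in_first K.
apply=> // h [i [j [ij ->]]].
have sm (r r' : {poly R}) a b : (size r <= a.+1)%N -> (size r' <= b.+1)%N ->
    (size (r * r')%R <= (a + b).+1)%N.
  move=> ra rb; apply: leq_trans (size_polyMleq _ _) _; lia.
have sphi k : (size (phi ^+ k)%R <= (d * k).+1)%N.
  by have := size_exp_le phi k; rewrite size_phi.
have sX : (size ('X^i : {poly R}) <= i.+1)%N by rewrite size_polyXn.
have xpX k : xp phi ^+ k = xp (phi ^+ k) by rewrite /xpoly !rmorphXn.
case: m12 => mE.
  rewrite curve1_y // xpX -xpolyM.
  apply: in_first_le (in_first_xpoly (sm _ _ _ _ sX (sphi j))).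
  by rewrite mE; nia.
have yj : y ^+ j = y ^+ odd j * xp (phi ^+ j./2).
  rewrite -xpX -curve_yX // [X in _ ^+ X ^+ _]mE -exprM -exprD mul2n.
  by rewrite odd_double_half.
rewrite yj mulrCA -xpolyM; case: (boolP (odd j)) => jo.
  rewrite expr1; apply: in_first_le
    (in_first_y_xpoly mE (sm _ _ _ _ sX (sphi _))).
  nia.
rewrite mul1r; apply: in_first_le
  (in_first_xpoly (sm _ _ _ _ sX (sphi _))).
rewrite mE; nia.
Qed.

Lemma window_coef n f i : Pi n.+1 f -> (forall g, Pi n g -> ip f g = 0) ->
  (i < d * (n.+1 - d))%N || (d * n.+1 < i)%N -> ip f (P i) = 0.
Proof.
move=> fPi fO /orP[/Pi_basis/fO //|ni].
exact: in_first_coef (Pi_in_first fPi) ni.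
Qed.

(** * Gram-Schmidt with possibly vanishing residuals *)

Implicit Types (prev cands : seq E).
Local Notation residual prev f :=
  (f - \sum_(h <- prev) curve_scale (ip f h) h).
Local Notation orth := (@orthogonalise R m phi I w).
Local Notation orth_seq := (@orthogonalise_seq R m phi I w).

(** The second conjunct says that h is zero or has norm one. *)
Definition orthonormal_or_zero (s : seq E) : bool :=
  pairwise (fun f g => ip f g == 0) s
  && all (fun h => curve_scale (ip h h) h == h) s.

(** If the norm is zero, so is f, and both sides are zero. *)
Lemma residual_scale f : curve_scale (Num.sqrt (ip f f))
  (curve_scale (Num.sqrt (ip f f))^-1 f) = f.
Proof.
have [f0|fn0] := eqVneq (ip f f) 0.
  by rewrite (ip_eq0 f0) !curve_scaler0.
rewrite curve_scaleA divff ?curve_scale1 // sqrtr_eq0 -ltNge.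
by rewrite lt_neqAle eq_sym fn0 ip_ge0.
Qed.

Lemma orthogonalise_in (U : E -> Prop) prev f : curve_subspace U ->
  (forall h, h \in prev -> U h) -> U f -> U (orth prev f).
Proof.
move=> sU prevU fU; apply: subspaceZ => //; apply: subspaceD => //.
apply: (subspaceN sU); apply: (subspace_sum sU) => h hp.
by apply: subspaceZ => //; apply: prevU.
Qed.

(** With [orthogonalise_in], this shows that replacing a candidate by its
    orthogonalisation does not change the span, even if the residual is 0. *)
Lemma orthogonalise_out (U : E -> Prop) prev f : curve_subspace U ->
  (forall h, h \in prev -> U h) -> U (orth prev f) -> U f.
Proof.
pose r := residual prev f.
move=> sU prevU /(subspaceZ (Num.sqrt (ip r r)) sU).
rewrite /orthogonalise residual_scale => gU.
rewrite -[f](subrK (\sum_(h <- prev) curve_scale (ip f h) h)).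
apply: subspaceD => //; apply: subspace_sum => // h hp.
by apply: subspaceZ => //; apply: prevU.
Qed.

Lemma orthogonalise_norm prev f (h := orth prev f) :
  curve_scale (ip h h) h = h.
Proof.
rewrite /h /orthogonalise; set g := f - _.
have [g0|gn0] := eqVneq (ip g g) 0.
  by rewrite (ip_eq0 g0) !curve_scaler0.
rewrite ipZl // ipC // ipZl // -[X in _ * (_ * X)](sqr_sqrtr (ip_ge0 g)).
have r0 : Num.sqrt (ip g g) != 0.
  by rewrite sqrtr_eq0 -ltNge lt_neqAle eq_sym gn0 ip_ge0.
by rewrite expr2 mulKf // mulVf // curve_scale1.
Qed.

(** A zero may occur several times in s, so the sum is split at the first
    occurrence of h; orthogonality of the rest still holds as <0, 0> = 0. *)
Lemma ip_projection (s : seq E) f h : orthonormal_or_zero s -> h \in s ->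
  \sum_(u <- s) ip f u * ip u h = ip f h.
Proof.
elim: s => // u s IH /andP[/= /andP[us ps] /andP[/eqP nu ns]].
rewrite big_cons inE => /orP[/eqP->|hs].
  rewrite big_seq big1 ?addr0 => [|v vs].
    by rewrite [ip f u]ipC // -[X in _ = ip X _]nu ipZl // mulrC.
  by rewrite [ip v u]ipC // (eqP (allP us _ vs)) mulr0.
by rewrite (eqP (allP us _ hs)) mulr0 add0r IH // /orthonormal_or_zero ps.
Qed.

Lemma residual_orthogonal prev f h : orthonormal_or_zero prev ->
  h \in prev -> ip (residual prev f) h = 0.
Proof.
move=> oz hp; rewrite ipDl // ipNl // ip_suml //.
under eq_bigr => u _ do rewrite ipZl //.
by rewrite ip_projection // subrr.
Qed.

Lemma orthogonalise_orthogonal prev f h : orthonormal_or_zero prev ->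
  h \in prev -> ip (orth prev f) h = 0.
Proof.
by move=> oz hp; rewrite ipZl // (residual_orthogonal _ oz hp) mulr0.
Qed.

Lemma orthonormal_or_zero_rcons prev f : orthonormal_or_zero prev ->
  orthonormal_or_zero (rcons prev (orth prev f)).
Proof.
move=> oz; move: (oz) => /andP[pp np].
rewrite /orthonormal_or_zero -cats1 pairwise_cat all_cat np pp /= andbT.
rewrite orthogonalise_norm eqxx andbT allrel1r andbT.
by apply/allP => h hp; rewrite ipC // orthogonalise_orthogonal.
Qed.

Lemma orthogonalise_seq_cat prev (fs gs : seq E) :
  orth_seq prev (fs ++ gs)
  = orth_seq prev fs ++ orth_seq (prev ++ orth_seq prev fs) gs.
Proof.
elim: fs prev => [|f fs IH] prev /=; first by rewrite cats0.
by rewrite IH -cat_rcons.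
Qed.

Lemma orthogonalise_seq_in (U : E -> Prop) prev cands : curve_subspace U ->
  (forall h, h \in prev -> U h) -> (forall h, h \in cands -> U h) ->
  forall h, h \in orth_seq prev cands -> U h.
Proof.
move=> sU; elim: cands prev => // c cands IH prev prevU cU h /=.
have oU : U (orth prev c).
  by apply: orthogonalise_in => //; apply: cU; rewrite mem_head.
rewrite inE => /orP[/eqP->//|]; apply: (IH (rcons prev (orth prev c))) => g.
  by rewrite mem_rcons inE => /orP[/eqP->//|/prevU].
by move=> gc; apply: cU; rewrite inE gc orbT.
Qed.

Lemma orthogonalise_seq_out (U : E -> Prop) prev cands : curve_subspace U ->
  (forall h, h \in prev -> U h) ->
  (forall h, h \in orth_seq prev cands -> U h) ->
  forall h, h \in cands -> U h.
Proof.
move=> sU; elim: cands prev => // c cands IH prev prevU /= oU h.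
have ocU : U (orth prev c) by apply: oU; rewrite mem_head.
rewrite inE => /orP[/eqP->|]; first exact: orthogonalise_out ocU.
apply: (IH (rcons prev (orth prev c))) => g.
  by rewrite mem_rcons inE => /orP[/eqP->//|/prevU].
by move=> gc; apply: oU; rewrite inE gc orbT.
Qed.

Lemma orthogonalise_seq_orthonormal prev cands : orthonormal_or_zero prev ->
  orthonormal_or_zero (prev ++ orth_seq prev cands).
Proof.
elim: cands prev => [|c cands IH] prev oz /=; first by rewrite cats0.
by rewrite -cat_rcons; apply/IH/orthonormal_or_zero_rcons.
Qed.

Lemma size_orthogonalise_seq prev cands :
  size (orth_seq prev cands) = size cands.
Proof. by elim: cands prev => //= c cands IH prev; rewrite IH. Qed.

(** * The OPs span the polynomials of bounded total degree *)

Local Notation L := (op_levels d I w (P 0%N)).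
Local Notation level n := (last [::] (L n)).

Lemma op_levelsS n : L n.+1 = rcons (L n) (level n.+1).
Proof. by rewrite /= last_rcons. Qed.

Lemma levelS n : level n.+1 = orth_seq (flatten (L n))
  (candidates d n ( *%R x) ( *%R y) (level n)).
Proof. by rewrite /= last_rcons. Qed.

Lemma flatten_op_levels n : flatten (L n.+1) = flatten (L n) ++ level n.+1.
Proof. by rewrite [in LHS]op_levelsS flatten_rcons. Qed.

Lemma size_op_levels n : size (L n) = n.+1.
Proof. by elim: n => //= n IH; rewrite size_rcons IH. Qed.

Lemma size_level n : size (level n) = minn n.+1 d.
Proof.
elim: n => [|n IH]; first by rewrite /=; lia.
by rewrite levelS size_orthogonalise_seq (size_candidates _ _ d_gt2 IH).
Qed.

Lemma op_levels_orthonormal n : orthonormal_or_zero (flatten (L n)).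
Proof.
elim: n => [|n IH]; last first.
  by rewrite flatten_op_levels levelS; apply: orthogonalise_seq_orthonormal.
rewrite /orthonormal_or_zero /= andbT.
by rewrite pbasis_orthonormal eqxx curve_scale1 eqxx.
Qed.

Lemma mem_flatten_level n h : h \in flatten (L n) ->
  h \in level n \/ ((0 < n)%N /\ h \in flatten (L n.-1)).
Proof.
case: n => [|n]; first by move=> hL; left.
by rewrite flatten_op_levels mem_cat => /orP[]; [right|left].
Qed.

Lemma Pi_P0 n : Pi n (P 0).
Proof.
apply: (@Pi_le 0%N) => //; rewrite /pbasis /=.
have p0 : Pi 0 (xp (p 0)) by apply: Pi_xpoly; rewrite (op_size pO).
by case: ifP => // _; apply: (subspaceZ _ (subspace_Pi _)).
Qed.

Lemma mem_candidates_Pi n (s : seq E) f :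
  (forall h, h \in s -> Pi n h) ->
  f \in candidates d n ( *%R x) ( *%R y) s -> Pi n.+1 f.
Proof.
move=> sP; rewrite /candidates; case: ifP => _.
  rewrite mem_cat => /orP[]/mapP[h hs ->]; first by apply: Pi_mulx; apply: sP.
  by apply: Pi_muly; apply: sP; move: hs => /mem_drop.
by move=> /mapP[h hs ->]; apply: Pi_muly; apply: sP.
Qed.

Lemma op_levels_Pi n h : h \in flatten (L n) -> Pi n h.
Proof.
elim: n h => [|n IH] h.
  by rewrite /= mem_seq1 => /eqP->; apply: Pi_P0.
rewrite flatten_op_levels mem_cat => /orP[/IH|]; first exact: Pi_le.
rewrite levelS; apply: orthogonalise_seq_in; first exact: subspace_Pi.
  by move=> g /IH; apply: Pi_le.
move=> g; apply: mem_candidates_Pi => u ul; apply: IH.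
case: n ul => [//|n ul].
by rewrite flatten_op_levels mem_cat ul orbT.
Qed.

(** Pi_n is contained in the span of the OPs of degree at most n; the converse
    is [op_levels_Pi]. *)
Definition spans_Pi n : Prop :=
  forall f U, Pi n f -> curve_subspace U ->
  (forall h, h \in flatten (L n) -> U h) -> U f.

Lemma level_in_op_levels n h : h \in level n -> h \in flatten (L n).
Proof.
case: n => [//|n hl]; by rewrite flatten_op_levels mem_cat hl orbT.
Qed.

Lemma candidates_spanned n U f : curve_subspace U ->
  (forall h, h \in flatten (L n.+1) -> U h) ->
  f \in candidates d n ( *%R x) ( *%R y) (level n) -> U f.
Proof.
move=> sU LU; apply: (orthogonalise_seq_out (prev := flatten (L n))) => // h hL.
  by apply: LU; rewrite flatten_op_levels mem_cat hL.
by apply: LU; rewrite flatten_op_levels mem_cat levelS hL orbT.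
Qed.

(** Since z maps Pi_(n-1) into Pi_n, only the products with the OPs of degree
    exactly n must be found in U. *)
Lemma spans_mul n z U : (forall k, (k <= n)%N -> spans_Pi k) ->
  z = x \/ z = y -> curve_subspace U ->
  (forall h, h \in flatten (L n.+1) -> U h) ->
  (forall h, h \in level n -> U (z * h)) ->
  forall f, Pi n f -> U (z * f).
Proof.
move=> spanL zE sU LU lU f fPi.
apply: (spanL n (leqnn n) f (fun f => U (z * f))) => //.
  exact: subspace_mul.
move=> h /mem_flatten_level[/lU //|[n0 /op_levels_Pi hPi]].
have {}hPi : Pi n (z * h).
  by rewrite -(prednK n0); case: zE => ->; [apply: Pi_mulx|apply: Pi_muly].
apply: (spanL n (leqnn n)) => // g gL.
by apply: LU; rewrite flatten_op_levels mem_cat gL.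
Qed.

(** Below degree d, all OPs but the last one of a level stem from x products. *)
Lemma take_level n : (n.+1 < d)%N ->
  take n.+1 (level n.+1) = orth_seq (flatten (L n)) [seq x * h | h <- level n].
Proof.
move=> nd; rewrite levelS /candidates nd orthogonalise_seq_cat take_size_cat //.
by rewrite size_orthogonalise_seq size_map size_level; lia.
Qed.

(** For n + 1 < d all x Y are candidates, but y Y only for the last OP of
    degree n.  The other OPs of degree n come from products x Y', and
    y (x Y') = x (y Y').  For n + 1 >= d all y Y are candidates; a monomial that
    is not a multiple of y is a power of x, and dividing it by phi = y^m leaves
    a multiple of y and terms of total degree at most n. *)
Lemma spans_PiS n : (forall k, (k <= n)%N -> spans_Pi k) -> spans_Pi n.+1.
Proof.
move=> spanL f U fPi sU LU.
have cU := candidates_spanned sU LU.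
have PiU g : Pi n g -> U g.
  move=> gPi; apply: (spanL n (leqnn n)) => // h hL.
  by apply: LU; rewrite flatten_op_levels mem_cat hL.
have [nd|dn] := ltnP n.+1 d.
  have xU : forall g, Pi n g -> U (x * g).
    apply: (spans_mul spanL) => //; first by left.
    move=> h hl; apply: cU; rewrite /candidates nd mem_cat.
    by rewrite (map_f ( *%R x)).
  have yU : forall g, Pi n g -> U (y * g).
    apply: (spans_mul spanL) => //; first by right.
    move=> h; rewrite -{1}(cat_take_drop n (level n)) mem_cat => /orP[hl|hl].
      case: (posnP n) hl => [->|n0] hl; first by rewrite take0 in hl.
      have [k nE] : exists k, n = k.+1 by exists n.-1; lia.
      subst n; move: hl; rewrite take_level; last by lia.
      apply: (orthogonalise_seq_in (U := fun h => U (y * h))).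
      - exact: subspace_mul.
      - by move=> g /op_levels_Pi gPi; apply: PiU; apply: Pi_muly.
      move=> _ /mapP[g gl ->]; rewrite mulrCA; apply: xU; apply: Pi_muly.
      by apply: op_levels_Pi; apply: level_in_op_levels.
    apply: cU; rewrite /candidates nd mem_cat.
    by rewrite (map_f ( *%R y)) // orbT.
  apply: fPi => // h [i [j [ij ->]]].
  have [ijn|nij] := leqP (i + j) n.
    by apply: PiU; apply: mem_curve_span; exists i, j.
  case: i ij nij => [|i] ij nij.
    case: j ij nij => [//|j] ij nij.
    rewrite exprS mulrCA; apply: yU; apply: mem_curve_span.
    by exists 0%N, j; split=> //; lia.
  rewrite exprS xpolyM // -mulrA; apply: xU; apply: mem_curve_span.
  by exists i, j; split=> //; lia.
have yU : forall g, Pi n g -> U (y * g).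
  apply: (spans_mul spanL) => //; first by right.
  move=> h hl; apply: cU; rewrite /candidates ltnNge dn /=.
  by rewrite (map_f ( *%R y)).
apply: fPi => // h [i [j [ij ->]]].
have [ijn|nij] := leqP (i + j) n.
  by apply: PiU; apply: mem_curve_span; exists i, j.
case: j ij nij => [|j] ij nij; last first.
  rewrite exprS mulrCA; apply: yU; apply: mem_curve_span.
  by exists i, j; split=> //; lia.
have -> : i = n.+1 by lia.
rewrite mulr1 xpoly_divp; apply: (subspaceD sU).
  rewrite -[X in _ ^+ X](prednK m_gt0) exprS -mulrA; apply: yU.
  apply: (@Pi_le (n.+1 - d + m.-1)%N); first by case: m12 => ->; lia.
  apply: Pi_mulyX; apply: Pi_xpoly; apply: size_divphi.
  by rewrite size_polyXn; lia.
by apply: PiU; apply: Pi_xpoly; apply: leq_trans dn; exact: size_modphi.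
Qed.

Lemma op_levels_span n : spans_Pi n.
Proof.
elim/ltn_ind: n => -[_|n IH]; last by apply: spans_PiS => k kn; apply: IH.
move=> f U fPi sU LU; apply: fPi => // h [i [j [ij ->]]].
have [-> ->] : i = 0%N /\ j = 0%N by lia.
have UP : U (P 0) by apply: LU; rewrite /= inE.
rewrite mulrC; apply: (subspace_mul_xpoly (b := p) sU _ _ (K := 1)).
- exact: op_size pO.
- case=> // _; rewrite mul1r.
  move: UP; rewrite /pbasis /=; case: ifP => // _.
  move/(subspaceZ (Num.sqrt 2) sU).
  by rewrite curve_scaleA divff ?sqrtr_eq0 -?ltNge // curve_scale1.
by rewrite size_polyXn.
Qed.

Lemma orthogonal_Pi n f : (forall h, h \in flatten (L n) -> ip f h = 0) ->
  forall g, Pi n g -> ip f g = 0.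
Proof.
move=> fL g gPi; rewrite ipC //.
apply: (op_levels_span gPi (subspace_orthogonal f)) => h hL.
by rewrite ipC // fL.
Qed.

Lemma level_orthogonal n h : h \in level n.+1 ->
  forall g, Pi n g -> ip h g = 0.
Proof.
move=> hl; apply: orthogonal_Pi => g gL; rewrite ipC //.
have := op_levels_orthonormal n.+1.
rewrite flatten_op_levels /orthonormal_or_zero pairwise_cat.
by case/andP=> /andP[/allrelP/(_ g h gL hl)/eqP-> _ _].
Qed.

Lemma take_op_levels n N : (n <= N)%N -> take n.+1 (L N) = L n.
Proof.
elim: N => [|N IH] nN; first by have -> : n = 0%N by lia.
have [->|neN] := eqVneq n N.+1; first by rewrite take_oversize ?size_op_levels.
by rewrite op_levelsS -cats1 takel_cat ?size_op_levels ?IH //; lia.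
Qed.

(** The three-term recurrences: move z to the other side, where z g has total
    degree below that of h. *)
Lemma mul_level_orthogonal z n h g : z = x \/ z = y -> h \in level n ->
  g \in flatten (take n.-1 (L n)) -> ip (z * h) g = 0.
Proof.
move=> zE; case: n => [|[|n]] hl; rewrite ?take0 // take_op_levels => [gL|];
  last by lia.
rewrite ip_mul //; apply: (level_orthogonal hl).
by case: zE => ->; [apply: Pi_mulx|apply: Pi_muly]; apply: op_levels_Pi.
Qed.

Lemma nth_op_levels n N : (n <= N)%N -> nth [::] (L N) n = level n.
Proof.
elim: N => [|N IH] nN; first by have -> : n = 0%N by lia.
rewrite op_levelsS nth_rcons size_op_levels ltnS.
case: (ltngtP n N.+1) nN => [nN _|//|-> _].
  by rewrite ltnS in nN; rewrite nN IH.
by rewrite ltnn.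
Qed.

(** * The procedure computes the OPs *)

Local Notation coef := (@coef R 0).
Local Notation dot := (@dot R 0).
Local Notation subtract_components := (@subtract_components R 0).
Implicit Types (u v : bvec R).

Definition vec_curve (v : bvec R) : E :=
  \sum_(i <- indices v) curve_scale (coef v i) (P i).

Lemma ip_vec_curve v i : ip (vec_curve v) (P i) = coef v i.
Proof.
rewrite ip_suml //; under eq_bigr => j _ do rewrite ipZl // pbasis_orthonormal.
have := iota_uniq (start v) (size (entries v)); rewrite -/(indices v) => us.
have [iv|iv] := boolP (i \in indices v).
  rewrite (bigD1_seq i) //= eqxx mulr1 big1 ?addr0 // => j /negPf->.
  by rewrite mulr0.
rewrite coef_out // big_seq big1 // => j jv.
by case: eqP => [ji|_]; rewrite ?mulr0 //; rewrite -ji jv in iv.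
Qed.

Lemma vec_curve_eq v f : (forall i, coef v i = ip f (P i)) -> vec_curve v = f.
Proof. by move=> vf; apply: basis_ext => i; rewrite ip_vec_curve. Qed.

Lemma dot_ip u v : run_prog (dot u v) = ip (vec_curve u) (vec_curve v).
Proof.
rewrite run_dot ip_suml //; apply: eq_bigr => i _.
by rewrite ipZl // ipC // ip_vec_curve.
Qed.

Lemma vec_curve_band_mul z M v : z = x \/ z = y -> is_mult_matrix P z M ->
  vec_curve (run_prog (band_mul 0 (2 * d) M v)) = z * vec_curve v.
Proof.
move=> zE zM; apply: vec_curve_eq => i.
rewrite coef_band_mul; last exact: mult_matrix_banded zM.
rewrite /vec_curve mulr_sumr ip_suml //; apply: eq_bigr => j _.
by rewrite curve_scaleAr ipZl // (mult_matrix_coef zM) mulrC.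
Qed.

(** The program truncates to win, which is harmless when the residual already
    has its coordinates there. *)
Lemma vec_curve_subtract win us v
  (r := residual (map vec_curve us) (vec_curve v)) :
  (forall i, (i < win.1)%N || (win.1 + win.2 <= i)%N -> ip r (P i) = 0) ->
  vec_curve (run_prog (subtract_components win us v)) = r.
Proof.
move=> rwin; apply: vec_curve_eq => i; rewrite coef_subtract.
case: ifP => [_|/negbT ni]; last by rewrite rwin //; lia.
rewrite /r ipDl // ipNl // ip_vec_curve ip_suml // big_map; congr (_ - _).
apply: eq_bigr => u _; rewrite ipZl // ip_vec_curve dot_ip.
by congr (_ * _); rewrite ipC.
Qed.

Lemma vec_curve_normalise v : vec_curve (run_prog (normalise 0 v)) =
  curve_scale (Num.sqrt (ip (vec_curve v) (vec_curve v)))^-1 (vec_curve v).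
Proof.
apply: vec_curve_eq => i.
by rewrite coef_normalise dot_ip ipZl // ip_vec_curve mulrC.
Qed.

Section Level.
Variables (n : nat) (Lv : seq (seq (bvec R))) (reorth : bool).
Hypothesis LvE : map (map vec_curve) Lv = L n.
Local Notation next_op := (@next_op R 0 reorth m d (curve_storage d) n Lv).

(** The residual along the three last degrees is the full residual, because the
    candidate is orthogonal to the earlier degrees; it lies in Pi_(n+1) and is
    orthogonal to Pi_n, so it fits the window.  The re-orthogonalisation then
    subtracts zero. *)
Lemma vec_curve_next_op cur cand
  (prev := flatten (L n) ++ map vec_curve cur)
  (f := vec_curve (run_prog cand)) :
  Pi n.+1 f -> (forall h, h \in map vec_curve cur -> Pi n.+1 h) ->
  (forall g, g \in flatten (take n.-1 (L n)) -> ip f g = 0) ->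
  orthonormal_or_zero prev ->
  vec_curve (run_prog (next_op cur cand)) = orth prev f.
Proof.
move=> fPi curPi f3 oz.
have prevPi h : h \in prev -> Pi n.+1 h.
  by rewrite mem_cat => /orP[/op_levels_Pi/(Pi_le (leqnSn n))|/curPi].
have win_sub g : Pi n.+1 g -> (forall h, h \in prev -> ip g h = 0) ->
    forall i, (i < d * (n.+1 - d))%N || (d * (n.+1 - d) + (d * d + 1) <= i)%N ->
    ip g (P i) = 0.
  move=> gPi gprev i iwin; apply: (window_coef gPi).
    by apply: orthogonal_Pi => h hL; apply: gprev; rewrite mem_cat hL.
  move: iwin => /orP[->//|ile]; apply/orP; right; nia.
have vec_flatten k : map vec_curve (flatten (drop k Lv) ++ cur)
    = flatten (drop k (L n)) ++ map vec_curve cur.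
  by rewrite map_cat map_flatten -LvE -map_drop.
rewrite /Defs.next_op run_bind run_bind run_bind -/f /=.
set r := run_prog (subtract_components _ _ _).
have rE : vec_curve r = residual prev f.
  have sumE : \sum_(h <- prev) curve_scale (ip f h) h =
      \sum_(h <- map vec_curve (flatten (drop n.-1 Lv) ++ cur))
        curve_scale (ip f h) h.
    rewrite vec_flatten /prev -{1}(cat_take_drop n.-1 (L n)) flatten_cat -catA.
    rewrite big_cat /= big_seq big1 ?add0r // => g gL.
    by rewrite f3 // curve_scale0.
  rewrite sumE; apply: vec_curve_subtract; rewrite -sumE; apply: win_sub.
    apply: (subspaceD (subspace_Pi _) fPi); apply: (subspaceN (subspace_Pi _)).
    apply: (subspace_sum (subspace_Pi _)) => h hp.
    by apply: (subspaceZ _ (subspace_Pi _)); apply: prevPi.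
  by move=> h hp; apply: residual_orthogonal.
have vE : vec_curve (run_prog (normalise 0 r)) = orth prev f.
  by rewrite vec_curve_normalise rE.
case: reorth; last by rewrite /= vE.
have sub0 :
    \sum_(h <- map vec_curve (flatten (drop (n + m + 2 - d)%N Lv) ++ cur))
      curve_scale (ip (orth prev f) h) h = 0.
  rewrite vec_flatten big_seq big1 // => h hs.
  rewrite orthogonalise_orthogonal ?curve_scale0 //.
  rewrite mem_cat; move: hs; rewrite mem_cat => /orP[hd|->];
    last by rewrite orbT.
  by rewrite -(cat_take_drop (n + m + 2 - d) (L n)) flatten_cat mem_cat hd orbT.
rewrite vec_curve_subtract; first by rewrite vE sub0 subr0.
rewrite vE sub0 subr0; apply: win_sub; last first.
  by move=> h hp; apply: orthogonalise_orthogonal.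
exact: orthogonalise_in (subspace_Pi _) prevPi fPi.
Qed.

Lemma vec_curve_fold (cands : seq (prog R (bvec R))) cur :
  (forall h, h \in map vec_curve cur -> Pi n.+1 h) ->
  orthonormal_or_zero (flatten (L n) ++ map vec_curve cur) ->
  (forall f, f \in [seq vec_curve (run_prog cand) | cand <- cands] ->
    Pi n.+1 f /\
    forall g, g \in flatten (take n.-1 (L n)) -> ip f g = 0) ->
  map vec_curve (run_prog (fold_prog
      (fun cur cand => let! v := next_op cur cand in Ret (rcons cur v))
      cur cands))
  = map vec_curve cur ++ orth_seq (flatten (L n) ++ map vec_curve cur)
      [seq vec_curve (run_prog cand) | cand <- cands].
Proof.
elim: cands cur => [|cand cands IH] cur curPi oz fs /=; first by rewrite cats0.
have [cPi c3] := fs _ (mem_head _ _).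
have vE := vec_curve_next_op cPi curPi c3 oz.
rewrite run_bind run_bind /=.
have mE := map_rcons vec_curve cur (run_prog (next_op cur cand)).
rewrite vE in mE; rewrite IH ?mE.
- by rewrite -cat_rcons -rcons_cat.
- move=> h; rewrite mem_rcons inE => /orP[/eqP->|/curPi//].
  apply: orthogonalise_in cPi => //; first exact: subspace_Pi.
  by move=> g; rewrite mem_cat => /orP[/op_levels_Pi/(Pi_le (leqnSn n))|/curPi].
- by rewrite -rcons_cat; apply: orthonormal_or_zero_rcons.
- by move=> f fin; apply: fs; rewrite inE fin orbT.
Qed.

End Level.

Variables (MX MY : nat -> nat -> R).
Hypothesis xMX : is_mult_matrix P x MX.
Hypothesis yMY : is_mult_matrix P y MY.

Lemma vec_curve_levels reorth N : map (map vec_curve)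
  (run_prog (lanczos_levels 0 1 reorth m d (curve_storage d) MX MY N)) = L N.
Proof.
elim: N => [|n IH] /=.
  congr [:: [:: _]]; apply: vec_curve_eq => i.
  by rewrite pbasis_orthonormal /Defs.coef /=; case: i => [|[|i]].
rewrite !run_bind /=; move: (run_prog _) IH => Lv LvE.
rewrite map_rcons LvE [RHS]op_levelsS levelS; congr rcons.
have zl (h : E) z : z = x \/ z = y -> h \in level n -> Pi n.+1 (z * h) /\
    forall g, g \in flatten (take n.-1 (L n)) -> ip (z * h) g = 0.
  move=> zE hl; split; last by move=> g; apply: mul_level_orthogonal.
  have := op_levels_Pi (level_in_op_levels hl).
  by case: zE => ->; [apply: Pi_mulx|apply: Pi_muly].
have candE : [seq vec_curve (run_prog cand) | cand <- candidates d n
      (mul_x 0 (curve_storage d) MX) (mul_y 0 (curve_storage d) MY)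
      (last [::] Lv)]
    = candidates d n ( *%R x) ( *%R y) (level n).
  have lE : level n = map vec_curve (last [::] Lv).
    by rewrite -LvE; exact: (last_map (map vec_curve) Lv [::]).
  rewrite lE /candidates -map_drop; case: ifP => _.
    rewrite map_cat -!map_comp; congr cat; apply: eq_map => v /=.
      by apply: vec_curve_band_mul xMX; left.
    by apply: vec_curve_band_mul yMY; right.
  rewrite -!map_comp; apply: eq_map => v /=.
  by apply: vec_curve_band_mul yMY; right.
rewrite vec_curve_fold // ?cats0 ?candE //; first exact: op_levels_orthonormal.
move=> f; rewrite /candidates; case: ifP => _.
  rewrite mem_cat => /orP[]/mapP[h hl ->]; apply: zl => //; first by left.
    by right.
  exact: mem_drop hl.
by move=> /mapP[h hl ->]; apply: zl => //; right.
Qed.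

Lemma lanczos_is_correct reorth N : lanczos_correct d I w P
  (curve_op d I w (P 0%N)) N
  (run_prog (lanczos 0 1 reorth m d (curve_storage d) MX MY N)).
Proof.
rewrite /lanczos 5!run_bind.
have := vec_curve_levels reorth N.
move: (run_prog (lanczos_levels _ _ _ _ _ _ _ _ _)) => Lv LvE.
have levE n : (n <= N)%N -> map vec_curve (nth [::] Lv n) = level n.
  move=> nN; rewrite -(nth_op_levels nN) -LvE (nth_map [::]) //.
  by rewrite -(size_map (map vec_curve)) LvE size_op_levels.
have vE n k : (n <= N)%N -> (k < minn n.+1 d)%N ->
    vec_curve (nth (BVec 0 [::]) (nth [::] Lv n) k)
    = curve_op d I w (P 0%N) n k.
  move=> nN kn; rewrite /curve_op -levE // (nth_map (BVec 0 [::])) //.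
  by rewrite -(size_map vec_curve) levE // size_level.
have szE n : (n <= N)%N -> size (nth [::] Lv n) = minn n.+1 d.
  by move=> nN; rewrite -(size_map vec_curve) levE // size_level.
have blockE z mul shift len n i j :
    (forall v, vec_curve (run_prog (mul v)) = z * vec_curve v) ->
    (n < len)%N -> (n + shift <= N)%N ->
    (i < minn (n + shift).+1 d)%N -> (j < minn n.+1 d)%N ->
    block_entry 0 (run_prog (jacobi_blocks 0 mul shift len Lv)) n i j
    = ip (curve_op d I w (P 0%N) (n + shift) i)
         (z * curve_op d I w (P 0%N) n j).
  move=> mulE nlen nN iN jN; rewrite /block_entry /jacobi_blocks run_map_prog.
  rewrite (nth_map 0%N) ?size_iota // nth_iota // add0n run_map_prog.
  have nN' : (n <= N)%N by lia.
  rewrite (nth_map (BVec 0 [::])) ?szE // run_bind run_map_prog.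
  by rewrite (nth_map (BVec 0 [::])) ?szE // dot_ip mulE !vE.
have mulxE v :
    vec_curve (run_prog (mul_x 0 (curve_storage d) MX v)) = x * vec_curve v.
  by apply: vec_curve_band_mul xMX; left.
have mulyE v :
    vec_curve (run_prog (mul_y 0 (curve_storage d) MY v)) = y * vec_curve v.
  by apply: vec_curve_band_mul yMY; right.
split=> /=.
- by move=> n k nN kn; apply: is_coordsE => i; rewrite -vE // ip_vec_curve.
- by move=> n i j nN iN jN; rewrite (blockE x) // ?addn0.
- by move=> n i j nN iN jN; rewrite (blockE y) // ?addn0.
- by move=> n i j nN iN jN; rewrite (blockE x) // ?addn1.
- by move=> n i j nN iN jN; rewrite (blockE y) // ?addn1.
Qed.

End LanczosOnCurve.

(** * Operation counts *)

Section LanczosCost.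
Context {R : realType} (m d : nat) (MX MY : nat -> nat -> R) (reorth : bool).
Hypothesis m_gt0 : (0 < m)%N.
Hypothesis d_gt2 : (2 < d)%N.
Local Notation W := (d * d + 1)%N.
Local Notation fitsW := (@fits R W).
Local Notation next_op := (@next_op R 0%R reorth m d (curve_storage d)).
Local Notation lanczos_levels :=
  (@lanczos_levels R 0%R 1%R reorth m d (curve_storage d) MX MY).

(** 3 d^2 bounds the d^2 + 1 + 4d entries and 10 d the 2 (4d + 1) operations for
    each of them, as d >= 3. *)
Lemma count_mul M (v : bvec R) : fitsW v ->
  (op_count (@band_mul R 0%R (2 * d) M v) <= 30 * d ^ 3)%N.
Proof.
rewrite /fits => vW; apply: leq_trans (count_band_mul _ _ _) _.
have -> : (30 * d ^ 3 = (3 * (d * d)) * (10 * d))%N.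
  by rewrite !expnS expn0 muln1; ring.
apply: leq_mul; nia.
Qed.

Lemma count_dot_le (u v : bvec R) : fitsW u ->
  (op_count (@dot R 0%R u v) <= 4 * d ^ 2)%N.
Proof.
rewrite /fits => uW; apply: leq_trans (count_dot _ _) _.
by rewrite !expnS expn0 muln1; nia.
Qed.

Lemma count_subtract_le n us (g : bvec R) k :
  all fitsW us -> (size us <= k)%N ->
  (op_count (@subtract_components R 0%R (window (curve_storage d) n) us g)
   <= 8 * d ^ 2 * k)%N.
Proof.
move=> usW usk; apply: leq_trans (count_subtract _ _ usW) _ => /=.
rewrite (_ : _ + _ = 4 * W * size us)%N; last by ring.
by apply: leq_mul usk; rewrite !expnS expn0 muln1; nia.
Qed.

Definition op_cost : nat :=
  (57 * d ^ 3 + if reorth then 8 * d ^ 4 else 0)%N.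

Definition stored_levels n (L : seq (seq (bvec R))) : Prop :=
  [/\ size L = n.+1, size (last [::] L) = minn n.+1 d,
      all (fun l => size l <= d)%N L & all (all fitsW) L].

Lemma size_next_op n L cur cand : fitsW (run_prog (next_op n L cur cand)).
Proof.
rewrite /fits /Defs.next_op run_bind run_bind run_bind.
by case: reorth; rewrite /= ?size_normalise size_subtract.
Qed.

(** One product (30 d^3), at most 3d components (24 d^3) and one normalisation
    (3 d^3).  The re-orthogonalisation involves at most d - 1 full levels and
    the current one, hence at most d^2 vectors. *)
Lemma count_next_op n L cur cand : stored_levels n L ->
  (size cur <= d)%N -> all fitsW cur ->
  (op_count cand <= 30 * d ^ 3)%N ->
  (op_count (next_op n L cur cand) <= op_cost)%N.
Proof.
case=> sL _ Ld LW curd curW candc.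
have usW k : all fitsW (flatten (drop k L) ++ cur).
  by rewrite all_cat all_flatten all_drop.
have usk k : (size (flatten (drop k L) ++ cur) <= (n.+1 - k) * d + d)%N.
  rewrite size_cat leq_add // -sL -size_drop.
  by apply: size_flatten_le; apply: all_drop.
rewrite /Defs.next_op count_bind count_bind count_bind /op_cost.
set g := run_prog cand; set r := run_prog _.
have c1 : (op_count (@subtract_components R 0%R (window (curve_storage d) n.+1)
    (flatten (drop n.-1 L) ++ cur) g) <= 8 * d ^ 2 * (3 * d))%N.
  apply: count_subtract_le => //; apply: leq_trans (usk _) _.
  have : (n.+1 - n.-1 <= 2)%N by lia.
  nia.
have c2 := count_normalise r.
have sr : size (entries r) = W by rewrite /r size_subtract.
set v := run_prog _.
have c3 : (op_count (if reorth then @subtract_components R 0%R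
     (window (curve_storage d) n.+1) (flatten (drop (n + m + 2 - d) L) ++ cur) v
     else Ret v) <= if reorth then 8 * d ^ 4 else 0)%N.
  case: reorth => //=.
  apply: leq_trans (count_subtract_le _ _ (usW _) (usk _)) _.
  have le_d : ((n.+1 - (n + m + 2 - d)) * d + d <= d * d)%N.
    have : (n.+1 - (n + m + 2 - d) <= d.-1)%N by lia.
    by move: d_gt2; case: (d) => // d' _ /= /(leq_mul (leqnn d'.+1)); lia.
  apply: leq_trans (leq_mul (leqnn _) le_d) _.
  by rewrite !expnS expn0 muln1; lia.
have d3 : (30 * d ^ 3 + 8 * d ^ 2 * (3 * d) + (3 * W + 1) <= 57 * d ^ 3)%N.
  by rewrite !expnS expn0 muln1; nia.
apply: leq_trans (leq_add candc (leq_add c1 (leq_add c2 c3))) _.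
by rewrite !addnA leq_add2r sr (mulnC W) -addnA.
Qed.

Lemma count_fold_next_op n L (cands : seq (prog R (bvec R))) cur
  (p := fold_prog (fun cur cand => let! v := next_op n L cur cand in
                                   Ret (rcons cur v)) cur cands) :
  stored_levels n L -> (size cur + size cands <= d)%N -> all fitsW cur ->
  all (fun cand => op_count cand <= 30 * d ^ 3)%N cands ->
  [/\ (op_count p <= size cands * op_cost)%N,
      size (run_prog p) = (size cur + size cands)%N &
      all fitsW (run_prog p)].
Proof.
move=> Lst; rewrite /p {p}; elim: cands cur => [|cand cands IH] cur scur curW.
  by rewrite /= addn0.
case/andP=> candc /IH{}IH.
have c0 := @count_next_op n L cur cand Lst _ curW candc.
set v := run_prog (next_op n L cur cand).
have [||c1 sz fW] := IH (rcons cur v).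
- by rewrite size_rcons addSnnS.
- by rewrite all_rcons curW size_next_op.
set F := fun _ _ => _ in c0 c1 sz fW *.
have stepE : run_prog (F cur cand) = rcons cur v by rewrite /F run_bind.
rewrite [fold_prog _ _ _]/= count_bind run_bind stepE sz fW size_rcons addSnnS.
split=> //; rewrite mulSn leq_add // /F count_bind addn0; apply: c0.
by move: scur => /=; lia.
Qed.


Lemma lanczos_levels_cost n :
  stored_levels n (run_prog (lanczos_levels n)) /\
  (op_count (lanczos_levels n) <= n * (d * op_cost))%N.
Proof.
elim: n => [|n [Lst Lc]].
  split=> //; split=> //=; rewrite /fits /=; lia.
rewrite /= !run_bind !count_bind /= addn0.
move: (run_prog (lanczos_levels n)) Lst => L Lst.
case: (Lst) => sL sl Ld LW.
have lastW : all fitsW (last [::] L).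
  by case/lastP: (L) LW => // s l; rewrite all_rcons last_rcons => /andP[].
pose cands := candidates d n (mul_x 0 (curve_storage d) MX)
  (mul_y 0 (curve_storage d) MY) (last [::] L).
have scands : size cands = minn n.+2 d by exact: size_candidates.
have candsc : all (fun cand => op_count cand <= 30 * d ^ 3)%N cands.
  have mapc M s : all fitsW s -> all (fun cand => op_count cand <= 30 * d ^ 3)%N
      (map (@band_mul R 0%R (2 * d) M) s).
    by rewrite all_map; apply: sub_all => v; exact: count_mul.
  rewrite /cands /candidates.
  by case: ifP => _; rewrite ?all_cat !mapc ?all_drop.
have candsd : (size cands <= d)%N by rewrite scands geq_minr.
have [c sz fW] := @count_fold_next_op n L cands [::] Lst candsd isT candsc.
split; last first.
  rewrite mulSn addnC leq_add // /next_level.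
  by apply: leq_trans c _; rewrite leq_mul2r scands geq_minr orbT.
split; rewrite ?size_rcons ?sL ?last_rcons ?all_rcons //.
- by rewrite sz scands.
- by rewrite Ld sz scands geq_minr.
- by rewrite LW fW.
Qed.

Lemma count_jacobi_blocks M shift len n L : stored_levels n L ->
  (op_count (jacobi_blocks 0%R (@band_mul R 0%R (2 * d) M) shift len L)
   <= len * (34 * d ^ 4))%N.
Proof.
case=> _ _ Ld LW; rewrite -{2}(size_iota 0 len).
apply: (@count_map_prog R _ _ predT) => [k _|]; last exact: all_predT.
have nthP j : (size (nth [::] L j) <= d)%N /\ all fitsW (nth [::] L j).
  have [jL|Lj] := ltnP j (size L); last by rewrite nth_default.
  by split; [move/(all_nthP [::]): Ld; apply|move/(all_nthP [::]): LW; apply].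
have [rd rW] := nthP (k + shift)%N; have [cd cW] := nthP k.
apply: leq_trans (_ : d * (34 * d ^ 3) <= _)%N; last first.
  by rewrite mulnCA -expnS.
apply: leq_trans (leq_mul cd (leqnn _)).
apply: count_map_prog cW => v vW.
rewrite count_bind (_ : 34 * d ^ 3 = 30 * d ^ 3 + d * (4 * d ^ 2))%N;
  last first.
  by rewrite !expnS; ring.
apply: leq_add; first exact: count_mul.
apply: leq_trans (leq_mul rd (leqnn _)).
by apply: count_map_prog rW => u; exact: count_dot_le.
Qed.

(** N levels of d OPs, and 4N + 2 <= 6N Jacobi blocks of 34 d^4 operations each:
    57 + 8 + 6 * 34 = 269. *)
Lemma lanczos_cost N : (0 < N)%N ->
  (op_count (@lanczos R 0%R 1%R reorth m d (curve_storage d) MX MY N)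
   <= 269 * (N * d ^ if reorth then 5 else 4))%N.
Proof.
move=> N0; rewrite /lanczos 5!count_bind addn0.
have [Lst Lc] := lanczos_levels_cost N.
have jc M shift len := @count_jacobi_blocks M shift len N _ Lst.
have sum := leq_add Lc (leq_add (jc MX 0 N.+1) (leq_add (jc MY 0 N.+1)
  (leq_add (jc MX 1 N) (jc MY 1 N)))).
apply: leq_trans sum _; rewrite /op_cost.
have d34 : (d * d ^ 3 = d ^ 4)%N by rewrite -expnS.
have d45 : (d * d ^ 4 = d ^ 5)%N by rewrite -expnS.
have le45 : (d ^ 4 <= d ^ 5)%N by rewrite leq_exp2l; lia.
by case: reorth; rewrite ?addn0 !(mulnDr d) !(mulnCA d) ?d34 ?d45; nia.
Qed.

End LanczosCost.

(* The constant K and the storage scheme S do not depend on R, N, phi, w; the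
   storage depends on m and d only. *)
Theorem proposition5p7 :
  exists (K : nat) (S : nat -> nat -> storage),
  forall (R : realType) (m d N : nat) (I : set R) (w : R -> R)
    (phi : {poly R}) (p q : nat -> {poly R}) (MX MY : nat -> nat -> R),
  ((m = 1%N /\ (3 <= d)%N) \/ (m = 2%N /\ (4 <= d)%N)) ->
  (1 <= N)%N ->
  is_weight I w ->
  size phi = d.+1 ->
  (m = 2%N -> forall t, I t -> 0 < phi.[t]) ->
  is_orthonormal_polys I w p ->
  (m = 2%N -> is_orthonormal_polys I (fun t => phi.[t] * w t) q) ->
  let P := pbasis m phi p q in
  is_mult_matrix P (curve_x m phi) MX ->
  is_mult_matrix P (curve_y m phi) MY ->
  let Y := curve_op d I w (P 0%N) in
  let run := fun reorth : bool =>
    lanczos 0 1 reorth m d (S m d) MX MY N in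
  [/\ lanczos_correct d I w P Y N (run_prog (run false)),
      (op_count (run false) <= K * (N * d ^ 4))%N,
      lanczos_correct d I w P Y N (run_prog (run true)) &
      (op_count (run true) <= K * (N * d ^ 5))%N].
Proof.
exists 269%N, (fun _ d => curve_storage d).
move=> R m d N I w phi p q MX MY md N_gt0 wI size_phi phi_gt0 pO qO P xMX yMY.
move=> Y run.
have m12 : m = 1%N \/ m = 2%N by case: md => -[]; [left|right].
have m_gt0 : (0 < m)%N by case: m12 => ->.
have d_gt2 : (2 < d)%N by case: md => -[_]; lia.
split.
- exact: (lanczos_is_correct m12 wI phi_gt0 pO qO size_phi d_gt2 xMX yMY).
- exact: (lanczos_cost MX MY false m_gt0 d_gt2 N_gt0).
- exact: (lanczos_is_correct m12 wI phi_gt0 pO qO size_phi d_gt2 xMX yMY).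
- exact: (lanczos_cost MX MY true m_gt0 d_gt2 N_gt0).
Qed.
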